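(* \textsc{Upper Clique Transversal} can be solved in linear time in the class of proper interval graphs. That is, there is an algorithm that, given a proper interval graph $G=(V,E)$ and an integer $k$, decides in time $\mathcal{O}(|V|+|E|)$ whether $G$ contains a minimal clique transversal $S$ with $|S|\ge k$.
   Context: All graphs are finite, simple, and undirected. A clique is a set of pairwise adjacent vertices; it is maximal if it is not properly contained in another clique. A clique transversal in $G$ is a set $S\subseteq V(G)$ that intersects every maximal clique of $G$; it is minimal if it does not contain any other clique transversal. \textsc{Upper Clique Transversal} is the decision problem: given a graph $G$ and an integer $k$, does $G$ contain a minimal clique transversal $S$ such that $|S|\ge k$? A graph $G=(V,E)$ is a proper interval graph if there is a family $(I_v : v\in V)$ of closed intervals on the real line, no one of which contains another, such that two distinct vertices $u,v$ are adjacent if and only if $I_u\cap I_v\ne\emptyset$. Linear time means time linear in the number of vertices plus the number of edges. *)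

(* Defs.v *)
From HB Require Import structures.
From mathcomp Require Import all_boot all_order all_algebra.
From mathcomp Require Import classical_sets reals.

Set Implicit Arguments.
Unset Strict Implicit.
Unset Printing Implicit Defensive.

Import Order.TTheory GRing.Theory Num.Theory.

(* A finite simple graph is a symmetric irreflexive e : rel T, T : finType. *)
Section Graphs.
Variables (T : finType) (e : rel T).

Definition edges : {set {set T}} :=
  [set [set p.1; p.2] | p : T * T & e p.1 p.2].

(* The empty set is a clique; it is maximal only in the graph without
   vertices, which therefore has no clique transversal. *)
Definition clique (K : {set T}) : bool :=
  [forall x in K, forall y in K, (x != y) ==> e x y].

Definition maximal_clique (K : {set T}) : bool := maxset clique K.

Definition clique_transversal (S : {set T}) : bool :=
  [forall K : {set T}, maximal_clique K ==> (S :&: K != finset.set0)].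

Definition minimal_clique_transversal (S : {set T}) : bool :=
  minset clique_transversal S.

Definition upper_clique_transversal (k : int) : bool :=
  [exists S : {set T}, minimal_clique_transversal S && (k <= #|S|%:Z)%R].

Definition proper_interval_graph (R : realType) : Prop :=
  exists l r : T -> R,
    let I v : set R := [set` `[l v, r v]%R]%classic in
    [/\ forall v, (l v <= r v)%R,
        forall u v, u != v -> ~ (I u `<=` I v)%classic
      & forall u v, u != v -> (e u v <-> (I u `&` I v !=set0)%classic)].

End Graphs.

(* Model of computation: a unit-cost RAM with bounded words, programmed in a
   structured language over integer variables and integer arrays, both named
   by natural numbers.  A program mentions finitely many of them.  Every
   elementary operation (reading or writing a variable or an array cell, adding
   or subtracting, comparing, branching) costs at least one time unit; there
   is no multiplication. *)
Inductive expr : Type :=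
  | Lit of int
  | Var of nat
  | Get of nat & expr
  | Add of expr & expr
  | Sub of expr & expr.

Inductive test : Type :=
  | Lt of expr & expr
  | Eq of expr & expr
  | Not of test
  | And of test & test.

Inductive program : Type :=
  | Skip
  | Assign of nat & expr
  | Put of nat & expr & expr (* Put a i v is a[i] := v *)
  | Seq of program & program
  | If of test & program & program
  | While of test & program.

Record state : Type := State {
  var : nat -> int;
  arr : nat -> int -> int
}.

Definition set_var (s : state) (x : nat) (v : int) : state :=
  State (fun y => if y == x then v else var s y) (arr s).

Definition set_arr (s : state) (a : nat) (i v : int) : state :=
  State (var s)
    (fun b j => if (b == a) && (j == i) then v else arr s b j).

Fixpoint eval (s : state) (x : expr) : int :=
  match x with
  | Lit z => z
  | Var v => var s v
  | Get a i => arr s a (eval s i)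
  | Add y z => (eval s y + eval s z)%R
  | Sub y z => (eval s y - eval s z)%R
  end.

Fixpoint teval (s : state) (b : test) : bool :=
  match b with
  | Lt y z => (eval s y < eval s z)%R
  | Eq y z => eval s y == eval s z
  | Not d => ~~ teval s d
  | And d d' => teval s d && teval s d'
  end.

Fixpoint expr_cost (x : expr) : nat :=
  match x with
  | Lit _ | Var _ => 1
  | Get _ i => (expr_cost i).+1
  | Add y z | Sub y z => (expr_cost y + expr_cost z).+1
  end.

Fixpoint test_cost (b : test) : nat :=
  match b with
  | Lt y z | Eq y z => (expr_cost y + expr_cost z).+1
  | Not d => (test_cost d).+1
  | And d d' => (test_cost d + test_cost d').+1
  end.

(* No (sub)expression overflows: all values, hence also all array indices in
   use, have absolute value at most W. *)
Fixpoint expr_fits (W : nat) (s : state) (x : expr) : bool :=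
  (absz (eval s x) <= W) &&
  match x with
  | Lit _ | Var _ => true
  | Get _ i => expr_fits W s i
  | Add y z | Sub y z => expr_fits W s y && expr_fits W s z
  end.

Fixpoint test_fits (W : nat) (s : state) (b : test) : bool :=
  match b with
  | Lt y z | Eq y z => expr_fits W s y && expr_fits W s z
  | Not d => test_fits W s d
  | And d d' => test_fits W s d && test_fits W s d'
  end.

(* exec W p s t s': started in s, p terminates in s' after exactly t time
   units, without ever exceeding the word bound W (p is stuck on overflow). *)
Inductive exec (W : nat) : program -> state -> nat -> state -> Prop :=
  | ExecSkip s : exec W Skip s 1 s
  | ExecAssign x y s :
      expr_fits W s y ->
      exec W (Assign x y) s (expr_cost y).+1 (set_var s x (eval s y))
  | ExecPut a i y s :
      expr_fits W s i -> expr_fits W s y ->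
      exec W (Put a i y) s (expr_cost i + expr_cost y).+1
        (set_arr s a (eval s i) (eval s y))
  | ExecSeq p q s t s1 t1 s2 :
      exec W p s t s1 -> exec W q s1 t1 s2 ->
      exec W (Seq p q) s (t + t1) s2
  | ExecIfTrue b p q s t s1 :
      test_fits W s b -> teval s b -> exec W p s t s1 ->
      exec W (If b p q) s (test_cost b + t).+1 s1
  | ExecIfFalse b p q s t s1 :
      test_fits W s b -> ~~ teval s b -> exec W q s t s1 ->
      exec W (If b p q) s (test_cost b + t).+1 s1
  | ExecWhileTrue b p s t s1 t1 s2 :
      test_fits W s b -> teval s b ->
      exec W p s t s1 -> exec W (While b p) s1 t1 s2 ->
      exec W (While b p) s (test_cost b + t + t1).+1 s2
  | ExecWhileFalse b p s :
      test_fits W s b -> ~~ teval s b ->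
      exec W (While b p) s (test_cost b).+1 s.

(* Adjacency lists of a graph on 'I_n; neighbours come in arbitrary order. *)
Definition adjacency_lists (n : nat) (e : rel 'I_n)
    (adj : 'I_n -> seq 'I_n) : Prop :=
  forall u, uniq (adj u) /\ adj u =i e u.

Definition neighbours (n : nat) (adj : 'I_n -> seq 'I_n) : seq nat :=
  flatten [seq [seq val v | v <- adj u] | u <- enum 'I_n].

Definition offset (n : nat) (adj : 'I_n -> seq 'I_n) (i : nat) : nat :=
  \sum_(u < n | u < i) size (adj u).

Definition array_of_seq (s : seq nat) (i : int) : int :=
  if i is Posz j then Posz (nth 0 s j) else 0%R.

(* The input consists of variable 0 = n, variable 1 = k, and the adjacency
   lists stored one after the other in array 1; the list of vertex u occupies
   the cells from offset u included to offset u.+1 excluded, and array 0 holds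
   the offsets of 0, ..., n.  Everything else is 0. *)
Definition input (n : nat) (adj : 'I_n -> seq 'I_n) (k : int) : state :=
  State
    (fun x => match x with 0 => Posz n | 1 => k | _ => 0%R end)
    (fun a => match a with
       | 0 => array_of_seq [seq offset adj i | i <- iota 0 n.+1]
       | 1 => array_of_seq (neighbours adj)
       | _ => fun=> 0%R
       end).

(* Variable 0 holds the output. *)
Definition output (s : state) : int := var s 0.

(* p solves the decision problem Q (about a graph and an integer) on the graph
   class C in time O(|V| + |E|), on words of log2 (|V| + |E| + |k|) + O(1)
   bits. *)
Definition solves_in_linear_time
    (C : forall n : nat, rel 'I_n -> Prop)
    (Q : forall n : nat, rel 'I_n -> int -> bool) (p : program) : Prop :=
  exists c : nat,
    forall (n : nat) (e : rel 'I_n) (adj : 'I_n -> seq 'I_n) (k : int),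
      symmetric e -> irreflexive e -> C n e -> adjacency_lists e adj ->
      exists (t : nat) (s : state),
        [/\ exec (c * (n + #|edges e| + absz k + 1)) p (input adj k) t s,
            t <= c * (n + #|edges e| + 1)
          & output s = Posz (Q n e k)].

(* Main.v *)
(** In a proper interval graph the vertices can be placed so that every closed
neighbourhood is an interval of positions; the maximal cliques are then the
intervals [a, c(a)), where [a] is the left end of some neighbourhood and [c(a)]
is the number of neighbourhoods whose left end is at most [a].  Each vertex of
a minimal clique transversal has a private maximal clique, and ordering these
cliques [a_0 < a_1 < ...] one gets [c(a_i) < a_(i+2)].  Conversely, from such a
chain of left ends keep, in each clique, only the last vertex that is not in
the next one, and discard the rest of these cliques: what remains still meets
every maximal clique, and the kept vertices belong to every transversal inside
it.  So the optimum is the length of a longest chain, which a greedy scan finds.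

The left ends are computed without sorting.  In each component, a vertex of
least degree in the last level of a breadth-first search is a twin of an end of
the ordering.  In a second search, from this vertex, the levels are consecutive
blocks of positions, so the left end of the neighbourhood of [v] is the first
position of the level of [v] minus the number of neighbours of [v] in earlier
levels. *)

Require Import Defs.
From HB Require Import structures.
From mathcomp Require Import boolp classical_sets reals.
From mathcomp Require Import all_boot all_order all_algebra perm zify.

Set Implicit Arguments.
Unset Strict Implicit.
Unset Printing Implicit Defensive.

Import Order.TTheory GRing.Theory Num.Theory.

(** * Search levels and straight orders *)

Section Layers.
Variables (T : finType) (e : rel T).
Hypothesis e_sym : symmetric e.
Hypothesis e_irr : irreflexive e.

Definition degree (v : T) : nat := #|[set u | e v u]|.

(** Breadth-first search without a distance function: the vertices at distance less than [k] from
    [z], paired with those at distance exactly [k]. *)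
Fixpoint layers (z : T) (k : nat) : {set T} * {set T} :=
  if k is j.+1 then
    let: (B, F) := layers z j in
    (B :|: F, [set v | [exists u in F, e u v]] :\: (B :|: F))
  else (set0, [set z]).

Definition before z k := (layers z k).1.
Definition level z k := (layers z k).2.

Lemma before0 z : before z 0 = set0. Proof. by []. Qed.

Lemma level0 z : level z 0 = [set z]. Proof. by []. Qed.

Lemma beforeS z k : before z k.+1 = before z k :|: level z k.
Proof. by rewrite /before /level /=; case: (layers z k). Qed.

Lemma levelS z k :
  level z k.+1 = [set v | [exists u in level z k, e u v]] :\: before z k.+1.
Proof. by rewrite beforeS /before /level /=; case: (layers z k). Qed.

Lemma levelSP z k v :
  reflect (v \notin before z k.+1 /\ exists2 u, u \in level z k & e u v)
          (v \in level z k.+1).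
Proof.
rewrite levelS !in_setD in_set.
by apply: (iffP andP) => -[? /exists_inP].
Qed.

Lemma in_before_level z k v : v \in level z k -> v \notin before z k.
Proof.
by case: k => [|k]; [rewrite before0 in_set0 | case/levelSP].
Qed.

Lemma sub_before z : {homo before z : j k / j <= k >-> j \subset k}.
Proof.
apply: homo_leq => [A //|A B C|k]; [exact: subset_trans|].
by rewrite beforeS subsetUl.
Qed.

Lemma before_id z k : z \in before z k.+1.
Proof.
by apply: (subsetP (@sub_before z 1 k.+1 _)); rewrite // beforeS !inE eqxx orbT.
Qed.

Lemma level_unique z j k v : v \in level z j -> v \in level z k -> j = k.
Proof.
wlog ltjk : j k / j < k => [H vj vk|vj vk].
  by case: (ltngtP j k) => // ltjk; [|symmetry]; apply: H.
case/negP: (in_before_level vk); apply: (subsetP (sub_before z ltjk)).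
by rewrite beforeS inE vj orbT.
Qed.

Lemma before_level z k v :
  v \in before z k -> exists2 j, j < k & v \in level z j.
Proof.
elim: k => [|k IHk]; first by rewrite inE.
rewrite beforeS inE => /orP[/IHk[j ltjk vj]|vk]; last by exists k.
by exists j; first exact: ltnW.
Qed.

Lemma before_adj z k u v :
  u \in before z k -> e u v -> v \in before z k.+1.
Proof.
move=> /before_level[j ltjk uj] euv; apply: (subsetP (sub_before z _)) (_ : v \in before z j.+2).
  by rewrite ltnS.
rewrite beforeS inE; case vB: (v \in before _ _) => //=.
by apply/levelSP; rewrite vB; split=> //; exists u.
Qed.

Lemma before_sub_closed z k (A : {set T}) :
  closed e A -> z \in A -> before z k \subset A.
Proof.
move=> clA zA; suff /andP[]: (before z k \subset A) && (level z k \subset A) by [].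
elim: k => [|k /andP[sB sL]]; first by rewrite sub0set sub1set.
rewrite beforeS subUset sB sL /=; apply/subsetP => v /levelSP[_ [u uk euv]].
by rewrite -(clA _ _ euv) (subsetP sL).
Qed.

(** An empty level leaves nothing new to reach, so the search has exhausted the component of [z]. *)
Lemma before_closed z k : level z k.+1 = set0 -> closed e (before z k.+1).
Proof.
move=> L0 u v; suff H x y : e x y -> x \in before z k.+1 -> y \in before z k.+1.
  by move=> euv; apply/idP/idP; apply: H; rewrite // e_sym.
move=> exy /before_adj/(_ exy); by rewrite beforeS L0 setU0.
Qed.

(** Strict linear orders with the umbrella property: the ends of an edge are adjacent to everything
    between them, so closed neighbourhoods are intervals of the order. *)
Definition straight (lt : rel T) : Prop :=
  [/\ irreflexive lt, transitive lt, forall u v, u != v -> lt u v || lt v u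
    & forall u v w, lt u v -> lt v w -> e u w -> e u v && e v w].

Lemma straight_rev lt : straight lt -> straight (fun u v => lt v u).
Proof.
case=> lt_irr lt_tr lt_tot lt_umb; split=> //.
- by move=> v u w vu wv; apply: lt_tr wv vu.
- by move=> u v uv; rewrite orbC lt_tot.
move=> u v w ltvu ltwv euw; rewrite (e_sym u v) (e_sym v w) andbC.
by apply: lt_umb; rewrite // e_sym.
Qed.

(** Equality of closed neighbourhoods, with [x = y] allowed; exchanging twins is an automorphism. *)
Definition twins (x y : T) : Prop :=
  forall v, (v == x) || e x v = (v == y) || e y v.

Lemma tperm_twins x y : twins x y ->
  forall u v, e (tperm x y u) (tperm x y v) = e u v.
Proof.
move=> tw.
have [->|neq] := eqVneq x y; first by move=> u v; rewrite tperm1 !perm1.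
have exy : e x y by have := tw y; rewrite eqxx orTb [y == x]eq_sym (negbTE neq).
have eqN v : v != x -> v != y -> e x v = e y v.
  by move=> vx vy; have := tw v; rewrite (negbTE vx) (negbTE vy).
move=> u v.
case: tpermP => [->|->|/eqP ux /eqP uy]; case: tpermP => [->|->|/eqP vx /eqP vy];
  rewrite ?e_irr // 1?[e y x]e_sym //.
- by rewrite eqN.
- by rewrite eqN.
- by rewrite !(e_sym u) eqN.
- by rewrite !(e_sym u) eqN.
Qed.

Lemma straight_twins lt x y : twins x y ->
  straight lt -> straight (fun u v => lt (tperm x y u) (tperm x y v)).
Proof.
move=> tw [lt_irr lt_tr lt_tot lt_umb]; split.
- by move=> u; apply: lt_irr.
- by move=> v u w; apply: lt_tr.
- by move=> u v uv; apply: lt_tot; rewrite (inj_eq perm_inj).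
move=> u v w uv vw; rewrite -(tperm_twins tw) => euw.
by have := lt_umb _ _ _ uv vw euw; rewrite !(tperm_twins tw).
Qed.

(** If [w] was reached from [y], then [v] lies either between [z] and [y], where induction applies,
    or between [y] and [w], where the umbrella property makes it a neighbour of [y]. *)
Lemma before_between lt z k v w : straight lt ->
  w \in before z k -> lt z v -> lt v w -> v \in before z k.
Proof.
case=> lt_irr lt_tr lt_tot lt_umb wk zv.
elim: k w wk => [|k IHk] w; first by rewrite before0 inE.
rewrite !beforeS !inE => /orP[wk vw|wk vw]; first by rewrite (IHk w).
case: k => [|k] in IHk wk *.
  by move: wk vw; rewrite level0 !inE => /eqP->; move=> vz; case/negP: (lt_irr v); apply: lt_tr zv.
have [_ [y yk eyw]] := levelSP _ _ _ wk.
have yB : y \in before z k.+1 by rewrite beforeS inE yk orbT.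
have [->|neq] := eqVneq v y; first by rewrite yB.
case/orP: (lt_tot _ _ neq) => [vy|yv]; first by rewrite (IHk y).
have /andP[eyv _] := lt_umb _ _ _ yv vw eyw.
by have := before_adj yB eyv; rewrite beforeS inE.
Qed.

(** A neighbour [y] of [v] in the previous level cannot come after [u], or [u] would have been found
    earlier; so [u] lies under the umbrella of [y] and [v]. *)
Lemma level_clique_right lt z k u v : straight lt ->
  u \in level z k -> v \in level z k -> lt z u -> lt u v -> e u v.
Proof.
move=> st; have [lt_irr lt_tr lt_tot lt_umb] := st.
move=> uk vk zu uv; case: k => [|k] in uk vk *.
  by move: uk zu; rewrite level0 inE => /eqP->; rewrite lt_irr.
have [uB _] := levelSP _ _ _ uk; have [_ [y yk eyv]] := levelSP _ _ _ vk.
have yB : y \in before z k.+1 by rewrite beforeS inE yk orbT.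
have neq : y != u by apply: contraNneq uB => <-.
have yu : lt y u.
  case/orP: (lt_tot _ _ neq) => // uy; case/negP: uB.
  exact: before_between uy.
by case/andP: (lt_umb _ _ _ yu uv eyv).
Qed.

Lemma ex_lt_max lt (C : {set T}) z : transitive lt -> irreflexive lt ->
  (forall u v, u != v -> lt u v || lt v u) -> z \in C ->
  exists2 c, c \in C & forall v, v \in C -> v != c -> lt v c.
Proof.
move=> lt_tr lt_irr lt_tot zC.
pose below c := #|[set u in C | lt u c]|.
case: (@arg_maxnP _ z (mem C) below zC) => c cC maxc.
exists c => // v vC vc; case/orP: (lt_tot _ _ vc) => // cv.
suff: below c < below v by rewrite ltnNge [_ <= _]maxc.
apply: proper_card.
apply/properP; split.
  by apply/subsetP => u; rewrite !inE => /andP[-> uc]; apply: lt_tr cv.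
by exists c; rewrite !inE ?lt_irr ?andbF //; apply/andP.
Qed.

(** The last vertex [c] of the component is in the last level. Every neighbour of [c] is [x] or a
    neighbour of [x]: by the umbrella property if it precedes [x], by the clique property of the
    level if it follows. Least degree turns this inclusion into equality. *)
Lemma last_level_end lt z k x : straight lt -> level z k.+1 = set0 ->
  x \in level z k -> (forall y, y \in level z k -> degree x <= degree y) ->
  ~~ lt x z ->
  exists c, [/\ c \in before z k.+1,
    forall v, v \in before z k.+1 -> v != c -> lt v c & twins x c].
Proof.
move=> st L0 xk minx nxz; have [lt_irr lt_tr lt_tot lt_umb] := st.
have xB : x \in before z k.+1 by rewrite beforeS inE xk orbT.
have [c cB maxc] := ex_lt_max lt_tr lt_irr lt_tot xB.
exists c; split=> //.
have [-> //|neq] := eqVneq x c.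
have xc : lt x c by apply: maxc.
have zx : x != z -> lt z x by move=> /lt_tot; rewrite (negbTE nxz).
(* For [k = 0] the component is the single vertex [z], so [x] and [c] would coincide. *)
have k0 : 0 < k.
  rewrite lt0n; apply: contraTneq neq => k0; move: xk cB; rewrite k0.
  by rewrite beforeS level0 before0 !inE => /eqP-> /= /eqP->; rewrite negbK.
have xz : x != z.
  apply: contraTneq xk => ->; apply/negP => /(@level_unique z k 0).
  by rewrite level0 inE eqxx => /(_ isT) kE; rewrite kE in k0.
have cl v : v \in before z k.+1 -> lt x v -> e x v.
  move=> vB xv; apply: (level_clique_right st xk _ (zx xz) xv).
  move: vB; rewrite beforeS inE => /orP[vB|//].
  by case/negP: (in_before_level xk); apply: before_between (zx xz) xv.
have ck : c \in level z k.
  move: cB; rewrite beforeS inE => /orP[cB|//].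
  by case/negP: (in_before_level xk); apply: before_between (zx xz) xc.
have cloB := before_closed L0.
have sub v : e c v -> (v == x) || e x v.
  move=> ecv; have [//|vx] := eqVneq v x.
  have vB : v \in before z k.+1 by rewrite -(cloB c v).
  case/orP: (lt_tot _ _ vx) => [ltvx|]; last exact: cl.
  rewrite e_sym in ecv; by have /andP[+ _] := lt_umb _ _ _ ltvx xc ecv; rewrite e_sym.
have exc : e x c by apply: cl.
have subset : c |: [set u | e c u] \subset x |: [set u | e x u].
  apply/subsetP => v; rewrite !inE => /orP[/eqP->|/sub//]; by rewrite exc orbT.
have eqN : c |: [set u | e c u] = x |: [set u | e x u].
  apply/eqP; rewrite eqEcard subset !cardsU1 !inE !e_irr /=.
  by rewrite leq_add2l minx.
by move=> v; have /setP/(_ v) := eqN; rewrite !inE.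
Qed.

(* Twins may exchange their places, so [x] itself can be put first. *)
Lemma last_level_first lt z k x : straight lt -> level z k.+1 = set0 ->
  x \in level z k -> (forall y, y \in level z k -> degree x <= degree y) ->
  exists2 lt', straight lt' &
    forall v, v \in before z k.+1 -> v != x -> lt' x v.
Proof.
move=> st L0 xk minx.
(* Reversing the order if necessary, [x] is not before the source [z]. *)
have {lt st} [lt st nxz] : exists2 lt', straight lt' & ~~ lt' x z.
  have [xz|] := boolP (lt x z); last by exists lt.
  exists (fun u v => lt v u); first exact: straight_rev.
  by have [lt_irr lt_tr _ _] := st; apply/negP => /(lt_tr _ _ _ xz); rewrite lt_irr.
have xB : x \in before z k.+1 by rewrite beforeS inE xk orbT.
have [c [cB maxc tw]] := last_level_end st L0 xk minx nxz.
(* The transposition gives [x] the last place, held by [c]; the reversal makes it the first. *)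
exists (fun u v => lt (tperm x c v) (tperm x c u)).
  exact: straight_rev (straight_twins tw st).
move=> v vB vx; rewrite tpermL; apply: maxc.
  by case: tpermP.
by rewrite -{2}(tpermL x c) (inj_eq perm_inj).
Qed.

(* [v] is placed at [s v] and its closed neighbourhood occupies the positions
   from [L v] to [L v + degree v]. *)
Definition placed (b : nat) (D : {set T}) (s L : T -> nat) : Prop :=
  [/\ {in D &, injective s}, {in D, forall v, b <= s v < b + #|D|},
      {in D, forall v, b <= L v /\ L v + degree v < b + #|D|}
    & {in D &, forall u v, (u == v) || e v u = (L v <= s u <= L v + degree v)}].

Lemma placed0 s L : placed 0 set0 s L.
Proof. by split=> u; rewrite inE. Qed.

(** No edge leaves the closed set [D], and the positions of [C] start at [#|D|], where those of [D]
    end; across the two sets both sides of the adjacency condition are false. *)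
Lemma placedU (D C : {set T}) s L s' L' : closed e D -> [disjoint D & C] ->
  placed 0 D s L -> placed #|D| C s' L' ->
  placed 0 (D :|: C) (fun v => if v \in D then s v else s' v)
    (fun v => if v \in D then L v else L' v).
Proof.
move=> clD dis [s_inj s_bd L_bd s_adj] [s_inj' s_bd' L_bd' s_adj'].
have cDC : #|D :|: C| = #|D| + #|C|.
  by rewrite cardsU (disjoint_setI0 dis) cards0 subn0.
have inC v : v \in D :|: C -> v \notin D -> v \in C.
  by rewrite inE => /orP[->|].
split.
- move=> u v /inC uDC /inC vDC; case: ifPn => uD; case: ifPn => vD uv.
  + exact: s_inj.
  + have := s_bd _ uD; have := s_bd' _ (vDC vD); lia.
  + have := s_bd _ vD; have := s_bd' _ (uDC uD); lia.
  + by apply: s_inj'; auto.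
- move=> v /inC vDC; case: ifPn => vD; rewrite cDC.
  + have := s_bd _ vD; lia.
  + have := s_bd' _ (vDC vD); lia.
- move=> v /inC vDC; case: ifPn => vD; rewrite cDC.
  + have := L_bd _ vD; lia.
  + have := L_bd' _ (vDC vD); lia.
move=> u v /inC uDC /inC vDC.
case: (boolP (u \in D)) => uD; case: (boolP (v \in D)) => vD.
- exact: s_adj.
- have -> : (u == v) || e v u = false.
    apply/negbTE; rewrite negb_or; apply/andP; split.
      by apply: contraNneq vD => <-.
    by apply: contra vD => /clD ->.
  have := s_bd _ uD; have := L_bd' _ (vDC vD); lia.
- have -> : (u == v) || e v u = false.
    apply/negbTE; rewrite negb_or; apply/andP; split.
      by apply: contraNneq uD => ->.
    by apply: contra uD => /clD <-.
  have := L_bd _ vD; have := s_bd' _ (uDC uD); lia.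
by apply: s_adj'; auto.
Qed.

(* In an order with [z] first, the layers of the search from [z] are
   consecutive blocks of its component. *)
Lemma before_initial lt z k u v (C : {set T}) : straight lt ->
  {in C, forall x, x != z -> lt z x} -> z \in C ->
  u \in before z k -> v \in C -> lt v u -> v \in before z k.
Proof.
move=> st zmin zC uk vC vu; have [lt_irr lt_tr lt_tot lt_umb] := st.
have [vz|vz] := eqVneq v z; last exact: before_between (zmin _ vC vz) vu.
by case: k uk => [|k]; [rewrite inE | rewrite vz before_id].
Qed.

(** A member of the initial segment [B] has all its predecessors in [B], and a non-member is
    preceded by all of [B]; hence the rank decides membership. *)
Lemma initial_position lt b (C B : {set T}) v : straight lt ->
  B \subset C -> (forall x y, x \in B -> y \in C -> lt y x -> y \in B) ->
  v \in C -> (v \in B) = (b + #|[set u in C | lt u v]| < b + #|B|).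
Proof.
move=> [lt_irr lt_tr lt_tot lt_umb] BC dn vC; rewrite ltn_add2l.
apply/idP/idP => [vB|].
  apply: proper_card; apply/properP; split.
    by apply/subsetP => u; rewrite inE => /andP[uC]; apply: dn.
  by exists v; rewrite // inE lt_irr andbF.
apply: contraLR => vB; rewrite -leqNgt; apply: subset_leq_card.
apply/subsetP => u uB; rewrite inE (subsetP BC _ uB) /=.
have /lt_tot/orP[//|vu] : u != v by apply: contraNneq vB => <-.
by case/negP: vB; apply: dn vu.
Qed.

(** Positions are ranks in the component, shifted by [b]. The vertices of earlier levels not
    adjacent to [v] form an initial segment, which stays initial when the closed neighbourhood of
    [v] is added; so that neighbourhood is the block of positions between the two. *)
Lemma layers_placed lt b z K (Lf : T -> nat) : straight lt ->
  let C := before z K.+1 in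
  level z K.+1 = set0 -> {in C, forall x, x != z -> lt z x} ->
  (forall k v, v \in level z k ->
    Lf v = b + #|before z k :\: [set u | e v u]|) ->
  placed b C (fun v => b + #|[set u in C | lt u v]|) Lf.
Proof.
move=> st C L0 zmin LfE; have [lt_irr lt_tr lt_tot lt_umb] := st.
have zC : z \in C by apply: before_id.
have dnC k u v : u \in before z k -> v \in C -> lt v u -> v \in before z k.
  exact: (before_initial st zmin zC).
have pos B v := @initial_position lt b C B v st.
have cloC : closed e C := before_closed L0.
have BC k : before z k \subset C by apply: before_sub_closed.
have lvC k v : v \in level z k -> v \in C.
  by move=> vk; apply: (subsetP (BC k.+1)); rewrite beforeS inE vk orbT.
have clique k u v : u \in level z k -> v \in level z k -> lt u v -> e u v.
  move=> uk vk uv; have [uz|] := eqVneq u z; last first.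
    by move=> /(zmin _ (lvC _ _ uk)) zu; apply: level_clique_right st uk vk zu uv.
  move: uk vk uv; rewrite uz => /(@level_unique z k 0); rewrite level0 inE eqxx => -> //.
  by rewrite level0 inE => /eqP ->; rewrite lt_irr.
have adjC u v : v \in C -> (u == v) || e v u -> u \in C.
  by move=> vC /orP[/eqP-> //|/cloC <-].
(* the vertices before the neighbourhood of [v], and up to its end *)
pose X k v := before z k :\: [set u | e v u].
pose Y k v := X k v :|: (v |: [set u | e v u]).
have XC k v : X k v \subset C by apply: subset_trans (BC k); apply: subsetDl.
have YC k v : v \in C -> Y k v \subset C.
  move=> vC; rewrite subUset XC /=; apply/subsetP => u; rewrite !inE; exact: adjC.
(* If [y] before [x] were adjacent to [v], the umbrella property would make [x] adjacent to [v]
   too. *)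
have Xdn k v : v \in level z k ->
    forall x y, x \in X k v -> y \in C -> lt y x -> y \in X k v.
  move=> vk x y; rewrite !inE => /andP[nvx xk] yC yx.
  rewrite (dnC _ _ _ xk yC yx) andbT; apply: contra nvx => evy.
  have /lt_tot/orP[xv|vx] : x != v.
    by apply: contraTneq xk => ->; apply: in_before_level.
    by have /andP[_] := lt_umb _ _ _ yx xv (etrans (e_sym y v) evy); rewrite e_sym.
  by case/negP: (in_before_level vk); apply: dnC vx => //; apply: lvC vk.
have Ydn k v : v \in level z k ->
    forall x y, x \in Y k v -> y \in C -> lt y x -> y \in Y k v.
  move=> vk x y xY yC yx; have vC := lvC _ _ vk.
  rewrite !inE; have [yk|yk] := boolP (y \in before z k).
    by rewrite andbT orbCA orNb orbT.
  rewrite andbF /=; have [//|yv] := eqVneq y v.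
  have xN : (x == v) || e v x.
    move: xY; rewrite !inE => /orP[/andP[_ xk]|//].
    by case/negP: yk; apply: dnC yx.
  case/orP: (lt_tot _ _ yv) => [ltyv|vy].
    have : y \in before z k.+1.
      by apply: (dnC _ v); rewrite // beforeS inE vk orbT.
    rewrite beforeS inE (negbTE yk) /= => yk'.
    by rewrite e_sym (clique k).
  have [xv|xv] := eqVneq x v.
    by have := lt_tr _ _ _ vy yx; rewrite xv lt_irr.
  rewrite (negbTE xv) /= in xN.
  by case/andP: (lt_umb _ _ _ vy yx xN).
have cardY k v : v \in level z k -> #|Y k v| = (#|X k v| + degree v).+1.
  move=> vk; rewrite cardsU cardsU1 inE e_irr /= add1n.
  have -> : X k v :&: (v |: [set u | e v u]) = set0.
    apply/setP => u; rewrite !inE; case: (e v u) => //=.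
    by rewrite orbF; apply/andP => -[uk /eqP uv]; case/negP: (in_before_level vk); rewrite -uv.
  by rewrite cards0 subn0 addnS.
have lev v : v \in C -> exists k, v \in level z k.
  by move=> /before_level[k _ vk]; exists k.
split.
- move=> u v uC vC /eqP; rewrite eqn_add2l => /eqP eqc.
  apply/eqP/negPn/negP => /lt_tot/orP[uv|vu].
  + suff : #|[set w in C | lt w u]| < #|[set w in C | lt w v]| by rewrite eqc ltnn.
    apply: proper_card; apply/properP; split.
      by apply/subsetP => w; rewrite !inE => /andP[-> /lt_tr->].
    by exists u; rewrite !inE ?uC // lt_irr andbF.
  + suff : #|[set w in C | lt w v]| < #|[set w in C | lt w u]| by rewrite eqc ltnn.
    apply: proper_card; apply/properP; split.
      by apply/subsetP => w; rewrite !inE => /andP[-> /lt_tr->].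
    by exists v; rewrite !inE ?vC // lt_irr andbF.
- by move=> v vC; rewrite leq_addr -pos.
- move=> v vC; have [k vk] := lev _ vC.
  rewrite (LfE _ _ vk) leq_addr -addnA ltn_add2l -[X in X <= _]cardY //.
  by split=> //; apply: subset_leq_card; apply: YC.
(* Both bounds on the position of [u] become membership statements: [u] is in [Y k v] and not in
   [X k v]. *)
move=> u v uC vC; have [k vk] := lev _ vC.
rewrite (LfE _ _ vk) -addnA [X in _ && X]leq_add2l -[X in _ && X]ltnS -cardY //.
rewrite -[X in _ && X](ltn_add2l b) -pos ?YC //; last exact: Ydn.
rewrite leqNgt -pos //; [|exact: XC|exact: Xdn].
rewrite !inE; case: (e v u); rewrite ?orbT ?andbT //= orbF.
by have [->|] := eqVneq u v; rewrite ?(negbTE (in_before_level vk)) ?orbF ?andNb.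
Qed.

End Layers.

(** * Cliques and transversals along a placement *)

Section Greedy.
Variables (T : finType) (L : T -> nat).

Definition left_end (a : nat) : bool := [exists v, L v == a].

Definition cum (a : nat) : nat := #|[set v | L v <= a]|.

(* The number of cliques chosen among those starting before [i], and the least
   position at which the next but one, resp. the next clique after the last
   chosen one may start. *)
Fixpoint greedy (i : nat) : nat * nat * nat :=
  if i is j.+1 then
    let: (r, f1, f2) := greedy j in
    if left_end j && (f1 <= j) then (r.+1, f2, (cum j).+1) else (r, f1, f2)
  else (0, 0, 0).

(** The last condition leaves the middle one of three consecutive cliques a position outside the
    other two. *)
Definition chain (r : nat) (a : nat -> nat) : Prop :=
  [/\ forall i, i < r -> left_end (a i),
      forall i, i.+1 < r -> a i < a i.+1
    & forall i, i.+2 < r -> cum (a i) < a i.+2].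

(** The least start allowed for the clique of index [r.+1]; after an empty chain there is no
    constraint, hence 0. *)
Definition chain_end (a : nat -> nat) (r : nat) : nat :=
  if r is j.+1 then (cum (a j)).+1 else 0.

Lemma cum_mono : {homo cum : i j / i <= j}.
Proof.
move=> i j le_ij; apply: subset_leq_card; apply/subsetP => v.
by rewrite !inE => /leq_trans; apply.
Qed.

Lemma chain_prefix r a : chain r.+1 a -> chain r a.
Proof. by case=> H1 H2 H3; split=> i ir; [apply: H1|apply: H2|apply: H3]; exact: ltnW. Qed.

Lemma chain_mono r a i j : chain r a -> i <= j -> j < r -> a i <= a j.
Proof.
case=> _ H2 _; elim: j => [|j IHj]; first by rewrite leqn0 => /eqP->.
rewrite leq_eqVlt => /orP[/eqP-> //|ij jr].
by apply: leq_trans (ltnW (H2 _ jr)); apply: IHj => //; apply: ltnW.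
Qed.

Lemma greedy_chain x : exists a,
  let: (r, f1, f2) := greedy x in
  [/\ chain r a, forall i, i < r -> a i < x,
      f1 = chain_end a r.-1 & f2 = chain_end a r].
Proof.
elim: x => [|x [a]]; first by exists id; split=> //; split.
rewrite /=; case: (greedy x) => -[r f1] f2 [ch ax f1E f2E].
case: ifPn => [/andP[lx f1x]|_]; last first.
  by exists a; split=> // i ir; rewrite ltnW // ltnS ax.
exists (fun i => if i < r then a i else x); case: ch => H1 H2 H3; split.
- split=> i.
  + by rewrite ltnS => ir; case: ifP => [/H1|].
  + by rewrite ltnS => ir; rewrite ir; case: ifP => [/H2|_]; last exact: ax.
  + rewrite ltnS => ir; rewrite (ltnW ir); case: ifP => [/H3 //|ir'].
    have rE : r = i.+2 by lia.
    by move: f1x; rewrite f1E rE.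
- by move=> i ir; case: ifP => // /ax; lia.
- by rewrite f2E; case: (r) => [//|j] /=; rewrite ltnSn.
- by rewrite /= ltnn.
Qed.

(* Greedy stays ahead: its [i]-th clique ends no later than the [i]-th clique
   of any other chain. *)
Lemma greedy_optimal x :
  let: (r, f1, f2) := greedy x in
  [/\ f1 <= f2, forall y, x <= y -> f2 <= (cum y).+1
    & forall q a, chain q a -> (forall i, i < q -> a i < x) ->
      [/\ q <= r, q = r -> f2 <= chain_end a q /\ f1 <= chain_end a q.-1
        & q.+1 = r -> f1 <= chain_end a q]].
Proof.
elim: x => [|x].
  split=> // q a _; case: q => [|q] //; last by move/(_ 0 isT).
rewrite /=; case: (greedy x) => -[r f1] f2 [f12 f2x opt].
pose taken := left_end x && (f1 <= x).
rewrite -/taken.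
suff H q a : chain q a -> (forall i, i < q -> a i < x.+1) ->
   [/\ q <= r + taken, q = r + taken -> (if taken then (cum x).+1 else f2) <= chain_end a q
   /\ (if taken then f2 else f1) <= chain_end a q.-1 &
   q.+1 = r + taken -> (if taken then f2 else f1) <= chain_end a q].
  case: taken H => H.
    split=> [|y xy|q a ch ax].
    - exact: f2x.
    - by rewrite ltnS cum_mono // ltnW.
    - by have := H q a ch ax; rewrite addn1.
  split=> // [y xy|q a ch ax]; first by apply: f2x; apply: ltnW.
  by have := H q a ch ax; rewrite addn0.
move=> ch ax.
(* Either the chain ends with the clique at [x], or it lies below [x] and induction applies to it
   unchanged. *)
have [lastx|nlast] := boolP ((0 < q) && (a q.-1 == x)); last first.
  have ax' i : i < q -> a i < x.
    move=> iq; have /(_ q.-1) := ax; have := chain_mono ch (_ : i <= q.-1).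
    move: nlast; rewrite negb_and; lia.
  have [H1 H2 H3] := opt _ _ ch ax'.
  case: (taken); rewrite ?addn1 ?addn0; split=> //.
  - by rewrite ltnW.
  - by move=> qE; rewrite qE ltnn in H1.
  - by move=> [] /H2[].
case: q => [|q] // in ch ax lastx *; rewrite /= in lastx *.
move/eqP: lastx => aq.
have ax' i : i < q -> a i < x.
  move=> iq; rewrite -aq; have [_ H2 _] := ch.
  exact: leq_trans (H2 i iq) (chain_mono ch iq (ltnSn q)).
have [H1 H2 H3] := opt _ _ (chain_prefix ch) ax'.
have lx : left_end x by case: ch => H _ _; rewrite -aq; apply: H.
have endx : chain_end a q.-1 <= x.
  case: ch => _ _ H; case: (q) (H) aq => [|[|j]] //= /(_ j) + <-; exact.
(* If the chain without its last clique is as long as the greedy one, its gap condition bounds [f1]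
   by [x], so greedy takes [x] as well. *)
have f1x : q = r -> taken.
  by rewrite /taken lx => /H2[_] /leq_trans; apply.
rewrite aq; have f2b := f2x x (leqnn x).
case: (taken) f1x; rewrite ?addn1 ?addn0 ?ltnS => f1x; split=> //.
- by move=> [qE]; split=> //; have [] := H2 qE.
- by rewrite ltn_neqAle H1 andbT; apply/eqP => /f1x.
- by move=> qE; split=> //; apply: H3.
- by move=> qE; apply: leq_trans f12 f2b.
Qed.

End Greedy.

Lemma card_below (T : finType) (s : T -> nat) m : injective s ->
  (forall v, s v < #|T|) -> m <= #|T| -> #|[set v | s v < m]| = m.
Proof.
move=> position_inj position_lt mT; pose f v := Ordinal (position_lt v).
have f_inj : injective f by move=> u v /(congr1 val) /position_inj.
have -> : [set v | s v < m] = f @^-1: [set i : 'I_#|T| | i < m] by apply/setP => v; rewrite !inE.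
rewrite on_card_preimset; last first.
  apply/onW_bij/inj_card_bij => //; by rewrite card_ord.
by rewrite -sum1dep_card -(big_ord_widen_cond #|T| xpredT (fun _ => 1)) // sum1_card card_ord.
Qed.

(** * Longest chains and minimal clique transversals *)

Section Optimum.
Variables (T : finType) (e : rel T).
Hypothesis e_sym : symmetric e.
Variables (s L : T -> nat).
Hypothesis sL : placed e 0 [set: T] s L.

Lemma position_inj : injective s.
Proof. by case: sL => position_inj _ _ _ u v; apply: position_inj. Qed.

Lemma position_lt v : s v < #|T|.
Proof. by case: sL => _ /(_ v) + _ _; rewrite cardsT in_setT; apply. Qed.

Lemma position_adj u v : (u == v) || e v u = (L v <= s u <= L v + degree e v).
Proof. by case: sL => _ _ _; apply. Qed.

Lemma position_surj i : i < #|T| -> exists v, s v = i.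
Proof.
move=> iT; have f_inj : injective (fun v => Ordinal (position_lt v)).
  by move=> u v /(congr1 val) /position_inj.
have [g _ fg] : bijective (fun v => Ordinal (position_lt v)).
  by apply: inj_card_bij; rewrite ?card_ord.
by exists (g (Ordinal iT)); have := congr1 val (fg (Ordinal iT)).
Qed.

(** By symmetry of adjacency, [L u <= s v] holds exactly when [u] is placed no later than the right
    end of the neighbourhood of [v]; these vertices fill an initial run of positions. *)
Lemma cum_position v : cum L (s v) = (L v + degree e v).+1.
Proof.
have hiT : (L v + degree e v).+1 <= #|T|.
  by case: sL => _ _ /(_ v) + _; rewrite cardsT in_setT => /(_ isT) [].
rewrite -(card_below position_inj position_lt hiT); apply: eq_card => u; rewrite !inE ltnS.
have := position_adj u v; have := position_adj v u; rewrite [v == u]eq_sym [e u v]e_sym => -> adj.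
have := position_adj u u; have := position_adj v v; rewrite !eqxx /=.
lia.
Qed.

Lemma position_adj_cum u v : (u == v) || e v u = (L v <= s u < cum L (s v)).
Proof. by rewrite position_adj cum_position ltnS. Qed.

Lemma position_adj_refl v : L v <= s v < cum L (s v).
Proof. by rewrite -position_adj_cum eqxx. Qed.

Lemma position_adj_sym u v :
  (L v <= s u < cum L (s v)) = (L u <= s v < cum L (s u)).
Proof. by rewrite -!position_adj_cum eq_sym e_sym. Qed.

Definition block (a : nat) : {set T} := [set y | a <= s y < cum L a].

(** With [u] at position [a], a member [y] of the block is adjacent or equal to [u], so its
    neighbourhood starts at or before [a] and covers every member placed before [y]. *)
Lemma block_clique a : clique e (block a).
Proof.
apply/forall_inP => x xa; apply/forall_inP => y ya; apply/implyP => xy.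
wlog lexy : x y xa ya xy / s x <= s y.
  by case: (leqP (s x) (s y)) => [|/ltnW] H; [|rewrite e_sym]; apply; rewrite // eq_sym.
have [u uE] : exists u, s u = a.
  by apply: position_surj; move: xa (position_lt x); rewrite inE; lia.
have := position_adj_cum x y; rewrite (negbTE xy) e_sym /= => ->.
move: xa ya; rewrite !inE -uE.
have := position_adj_sym y u; have := position_adj_refl u; have := position_adj_refl y; lia.
Qed.

(** A clique containing the block contains a vertex [v] with [L v = a] and the vertex [u] at
    position [a]; adjacency to [v] bounds its positions from below, adjacency to [u] from above. *)
Lemma block_maximal a : left_end L a -> maximal_clique e (block a).
Proof.
case/existsP => v /eqP vE; apply/maxsetP; split; first exact: block_clique.
move=> K clK sub; apply/eqP; rewrite eqEsubset sub andbT.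
have avv := position_adj_refl v; rewrite vE in avv.
have [u uE] : exists u, s u = a by apply: position_surj; have := position_lt v; lia.
have := position_adj_sym u v; have := position_adj_refl u; rewrite uE vE => auu auv.
have vK : v \in K by apply: (subsetP sub); rewrite inE; lia.
have uK : u \in K by apply: (subsetP sub); rewrite inE; lia.
have adjK x y : x \in K -> y \in K -> (x == y) || e y x.
  move=> xK yK; have [//|xy] := eqVneq x y.
  by move/forall_inP: clK => /(_ _ yK)/forall_inP/(_ _ xK)/implyP; rewrite eq_sym; apply.
apply/subsetP => y yK; rewrite inE.
have := adjK _ _ yK vK; rewrite position_adj_cum vE => /andP[-> _] /=.
by have := adjK _ _ yK uK; rewrite position_adj_cum uE => /andP[].
Qed.

(** Let [u] be the first vertex of [K] and [w] the last one of its closed neighbourhood. All of [K]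
    lies between them, hence in the block that starts at [L w]. *)
Lemma maximal_block K : 0 < #|T| -> maximal_clique e K ->
  exists2 a, left_end L a & K = block a.
Proof.
move=> T0 /maxsetP[clK maxK].
have [z zK] : exists z, z \in K.
  apply/set0Pn; apply/eqP => K0; case/card_gt0P: T0 => w _.
  have /maxK : clique e [set w].
    apply/forall_inP => x; rewrite inE => /eqP->; apply/forall_inP => y.
    by rewrite inE => /eqP->; rewrite eqxx.
  by rewrite K0 sub0set => /(_ isT) /setP/(_ w); rewrite !inE eqxx.
have adjK x y : x \in K -> y \in K -> (x == y) || e y x.
  move=> xK yK; have [//|xy] := eqVneq x y.
  by move/forall_inP: clK => /(_ _ yK)/forall_inP/(_ _ xK)/implyP; rewrite eq_sym; apply.
case: (@arg_minnP _ z (mem K) s zK) => u uK minu.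
have /position_surj[w wE] : L u + degree e u < #|T|.
  by case: sL => _ _ /(_ u) + _; rewrite cardsT in_setT => /(_ isT) [].
exists (L w); first by apply/existsP; exists w.
symmetry; apply: maxK; first exact: block_clique.
have /position_surj[x xE] : L w < #|T|.
  have := position_adj_refl w; have := position_lt w; lia.
apply/subsetP => y yK.
have := position_adj_sym w u; have := position_adj_sym x w; rewrite xE.
have := position_adj_refl u; have := position_adj_refl w.
have := minu y yK; have := adjK _ _ yK uK; rewrite position_adj_cum inE /=.
have := cum_position u; lia.
Qed.

Lemma left_end_lt a : left_end L a -> a < cum L a <= #|T|.
Proof.
case/existsP => v /eqP vE; have vv := position_adj_refl v.
have [u uE] : exists u, s u = a by apply: position_surj; have := position_lt v; lia.
by have := position_adj_refl u; rewrite uE /cum max_card andbT => /andP[].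
Qed.

Lemma left_end_mono a b : left_end L b -> a < b -> cum L a < cum L b.
Proof.
case/existsP => v /eqP vE ab; apply: proper_card; apply/properP; split.
  by apply/subsetP => u; rewrite !inE => /leq_trans; apply; apply: ltnW.
by exists v; rewrite inE vE // -ltnNge.
Qed.

(** The vertex at [p i], the last position of the clique [i] before the next one starts, is the only
    vertex of that clique kept in [X], so every transversal inside [X] contains it. *)
Lemma chain_transversal r a : 0 < #|T| -> chain L r a ->
  exists2 S, minimal_clique_transversal e S & r <= #|S|.
Proof.
move=> T0 ch; have [endL incr gap] := ch.
pose p i := if i.+1 < r then minn (cum L (a i)).-1 (a i.+1).-1
            else (cum L (a i)).-1.
have own i : i < r -> a i <= p i < cum L (a i).
  move=> ir; have := left_end_lt (endL i ir); rewrite /p.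
  case: ifP => [/incr|_]; lia.
have aft i : i.+1 < r -> p i < a i.+1.
  move=> ir; rewrite /p ir; have := incr _ ir; lia.
have pre i : i.+1 < r -> cum L (a i) <= p i.+1.
  move=> ir; have := left_end_mono (endL _ ir) (incr _ ir); rewrite /p.
  case: ifP => [/gap|_]; lia.
(* Later chosen cliques start after [p i], earlier ones end before it. *)
have other i j : i < r -> j < r -> a j <= p i < cum L (a j) -> i = j.
  move=> ir jr; case: (ltngtP i j) => // ij.
    have := aft i (leq_ltn_trans ij jr); have := chain_mono ch ij jr; lia.
  case: i ir ij => // i ir; rewrite ltnS => ji; have := pre i ir.
  have := @cum_mono _ L _ _ (chain_mono ch ji (ltnW ir)); lia.
pose X := [set y | [forall i : 'I_r, (a i <= s y < cum L (a i)) ==> (s y == p i)]].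
have XP y : reflect (forall i, i < r -> a i <= s y < cum L (a i) -> s y = p i) (y \in X).
  rewrite inE; apply: (iffP forallP) => [H i ir | H i].
    by move=> yi; apply/eqP; apply: (implyP (H (Ordinal ir))).
  by apply/implyP => /H->.
have pX i y : i < r -> s y = p i -> y \in X.
  by move=> ir yE; apply/XP => j jr; rewrite yE => /(other _ _ ir jr)->.
have Xtr : clique_transversal e X.
  apply/forallP => K; apply/implyP => /(maximal_block T0)[c lc ->].
  apply/set0Pn.
  (* If no chosen clique starts at or before [c], the vertex at [c] is in none of them and was
     kept. *)
  have [/existsP[i0 i0P]|none] := boolP [exists i : 'I_r, a i <= c]; last first.
    have [y yE] : exists y, s y = c.
      by apply: position_surj; have := left_end_lt lc; lia.
    exists y; rewrite in_setI [y \in block _]inE yE leqnn; apply/andP; split.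
      apply/XP => i ir; rewrite yE => yi; case/existsP: none.
      by exists (Ordinal ir); case/andP: yi.
    by have := left_end_lt lc; lia.
  have exP : exists i, (i < r) && (a i <= c) by exists i0; rewrite ltn_ord.
  have ubP i : (i < r) && (a i <= c) -> i <= r by case/andP => /ltnW.
  (* Take the last chosen clique starting at or before [c]. If [c <= p i], the vertex at [p i] is in
     the block of [c]; otherwise [c] is past the end of this clique and before any later one, so its
     vertex was kept. *)
  case: (ex_maxnP exP ubP) => i /andP[ir aic] maxi.
  have nxt : i.+1 < r -> c < a i.+1.
    move=> ir'; rewrite ltnNge; apply/negP => H.
    by have := maxi i.+1; rewrite ir' H ltnn => /(_ isT).
  have [cp|pc] := leqP c (p i).
    have [y yE] : exists y, s y = p i.
      by apply: position_surj; have := left_end_lt (endL _ ir); have := own _ ir; lia.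
    exists y; rewrite in_setI (pX i) //= inE yE cp /=.
    by have := @cum_mono _ L _ _ aic; have := own _ ir; lia.
  have [y yE] : exists y, s y = c.
    by apply: position_surj; have := left_end_lt lc; lia.
  exists y; rewrite in_setI [y \in block _]inE yE leqnn; apply/andP; split; last first.
    by have := left_end_lt lc; lia.
  have cumc : cum L (a i) <= c.
    by move: pc nxt; rewrite /p; case: ifP => [_ + /(_ isT)|_ + _]; lia.
  apply/XP => j jr; rewrite yE => yj.
  case: (leqP j i) => ij.
    have := @cum_mono _ L _ _ (chain_mono ch ij ir); lia.
  have := nxt (leq_ltn_trans ij jr); have := chain_mono ch ij jr; lia.
have [S minS SX] := minset_exists Xtr.
exists S => //.
have /fin_all_exists[w wE] (i : 'I_r) : exists y, s y = p i.
  by apply: position_surj; have := left_end_lt (endL _ (ltn_ord i)); have := own _ (ltn_ord i); lia.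
have w_inj : injective w.
  move=> i j wij; apply: val_inj; apply: other => //=.
  by have <- : s (w i) = p i by []; rewrite wij wE own.
rewrite -[r in r <= _]card_ord -(card_imset _ w_inj).
apply: subset_leq_card; apply/subsetP => _ /imsetP[i _ ->].
have /minsetP[/forallP/(_ (block (a i)))/implyP trS _] := minS.
have /set0Pn[y] := trS (block_maximal (endL _ (ltn_ord i))).
rewrite !inE => /andP[yS yi].
have yE : s y = p i by apply: (XP _ (subsetP SX _ yS)).
by have -> : w i = y by apply: position_inj; rewrite wE yE.
Qed.

(** Sort [S] by position. As private cliques contain no other vertex of [S], the clique of one
    vertex ends before the next vertex, which in turn precedes the start of the clique after its
    own; together these give the gap. *)
Lemma transversal_chain S : 0 < #|T| -> minimal_clique_transversal e S ->
  exists2 a, chain L #|S| a & forall i, i < #|S| -> a i < #|T|.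
Proof.
move=> T0 /minsetP[trS minS].
have priv v : exists a, v \in S -> left_end L a /\ S :&: block a = [set v].
  have [vS|_] := boolP (v \in S); last by exists 0.
  (* By minimality, removing [v] leaves some maximal clique unmet: this one is private to [v]. *)
  have : ~~ clique_transversal e (S :\ v).
    apply/negP => /minS/(_ (subsetDl _ _))/setP/(_ v).
    by rewrite !inE eqxx vS.
  case/forallPn => K; rewrite negb_imply negbK => /andP[maxK /eqP K0].
  have [a la KE] := maximal_block T0 maxK.
  exists a => _; split=> //; rewrite -KE.
  have /set0Pn[y yK] := implyP (forallP trS K) maxK.
  have sub u : u \in S :&: K -> u = v.
    rewrite inE => /andP[uS uK]; apply/eqP; apply: contraT => uv.
    by have /setP/(_ u) := K0; rewrite !inE uv uS uK.
  apply/setP => u; rewrite [RHS]inE; apply/idP/eqP => [/sub //|->].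
  by rewrite -(sub y).
have /fin_all_exists[A AP] := priv.
case: (set_0Vmem S) => [->|[v0 v0S]]; first by exists id; rewrite cards0.
pose vs := sort (relpre s leq) (enum S).
have vs_size : size vs = #|S| by rewrite size_sort cardE.
have vs_mem u : (u \in vs) = (u \in S) by rewrite mem_sort mem_enum.
have vs_uniq : uniq vs by rewrite sort_uniq enum_uniq.
have vs_sorted : sorted (relpre s leq) vs by apply: sort_sorted => x y; apply: leq_total.
pose v i := nth v0 vs i.
have vS i : i < #|S| -> v i \in S by rewrite -vs_size -vs_mem; apply: mem_nth.
have vmono i : i.+1 < #|S| -> s (v i) < s (v i.+1).
  move=> ir; rewrite ltn_neqAle; apply/andP; split.
    rewrite (inj_eq position_inj) nth_uniq ?vs_size //; last exact: ltnW.
    by rewrite neq_ltn ltnSn.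
  by have /(sortedP v0)/(_ i) := vs_sorted; rewrite vs_size => /(_ ir).
have mem i j : i < #|S| -> j < #|S| ->
    (A (v j) <= s (v i) < cum L (A (v j))) = (v i == v j).
  move=> iS jS; have [_ /setP/(_ (v i))] := AP _ (vS _ jS).
  by rewrite !inE vS.
have bef i : i.+1 < #|S| -> A (v i) <= s (v i) /\ s (v i) < A (v i.+1).
  move=> ir; have := vmono i ir; have := mem _ _ (ltnW ir) (ltnW ir).
  have := mem _ _ (ltnW ir) ir; have := mem _ _ ir ir.
  have -> : (v i == v i.+1) = false.
    by apply/eqP => vE; have := vmono i ir; rewrite vE ltnn.
  rewrite !eqxx; lia.
have aft i : i.+1 < #|S| -> cum L (A (v i)) <= s (v i.+1).
  move=> ir; have := vmono i ir; have := mem _ _ (ltnW ir) (ltnW ir).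
  have := mem _ _ ir (ltnW ir).
  have -> : (v i.+1 == v i) = false.
    by apply/eqP => vE; have := vmono i ir; rewrite vE ltnn.
  rewrite !eqxx; lia.
exists (fun i => A (v i)); first split.
- by move=> i /vS/AP[].
- by move=> i ir; have := bef i ir; lia.
- by move=> i ir; have := aft i (ltnW ir); have := bef i.+1 ir; lia.
move=> i iS; have [/left_end_lt] := AP _ (vS _ iS); lia.
Qed.

Theorem upper_clique_transversal_greedy k :
  upper_clique_transversal e k =
  (0 < #|T|) && (k <= ((greedy L #|T|).1.1)%:Z)%R.
Proof.
(* Without vertices the empty set is a maximal clique that nothing meets. *)
have [T0|] := posnP #|T|.
  apply/negbTE/existsPn => S; apply/negP => /andP[/minsetP[/forallP + _] _].
  have SE : forall A : {set T}, A = set0.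
    by move=> A; apply/setP => x; have /card0_eq/(_ x) := T0; rewrite !inE.
  move=> /(_ set0)/implyP; rewrite (SE (_ :&: _)) eqxx => H.
  suff /H : maximal_clique e set0 by [].
  apply/maxsetP; split; last by move=> B _ _; apply: SE.
  by apply/forall_inP => x; rewrite inE.
move=> T0 /=; apply/existsP/idP => [[S /andP[minS kS]]|kr].
  have [a ch aT] := transversal_chain T0 minS.
  have := greedy_optimal L #|T|; case: (greedy L #|T|) => -[r f1] f2 [_ _ opt] /=.
  have [Sr _ _] := opt _ _ ch aT; lia.
have [a] := greedy_chain L #|T|.
case: (greedy L #|T|) kr => -[r f1] f2 /= kr [/(chain_transversal T0)[S minS rS] _ _ _].
by exists S; rewrite minS /=; lia.
Qed.

End Optimum.

(** * From intervals to straight orders *)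

(** Vertices are ordered by left endpoints. Since no interval contains another, these are distinct
    and the right endpoints come in the same order. *)
Lemma interval_straight (T : finType) (e : rel T) (R : realType) :
  proper_interval_graph e R -> exists lt, straight e lt.
Proof.
case=> l [r /= [lr proper adj]].
have sub u v : (l u <= l v)%R -> (r v <= r u)%R -> u = v.
  move=> luv rvu; apply/eqP; apply: contraT => uv.
  case: (proper v u); first by rewrite eq_sym.
  move=> x /=; rewrite !in_itv /= => /andP[lx xr].
  by rewrite (le_trans luv lx) (le_trans xr rvu).
have rmono u v : (l u < l v)%R -> (r u < r v)%R.
  move=> luv; rewrite ltNge; apply/negP => /(sub _ _ (ltW luv)) uv.
  by rewrite uv ltxx in luv.
exists (fun u v => (l u < l v)%R); split.
- by move=> u; rewrite ltxx.
- by move=> v u w; apply: lt_trans.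
- move=> u v uv; rewrite -neq_lt; apply: contra_neq uv => luv.
  by case/orP: (le_total (r v) (r u)) => [|/sub->//]; [apply: sub|]; rewrite luv.
move=> u v w uv vw euw.
have neq x y : (l x < l y)%R -> x != y by move=> xy; apply: contraTneq xy => ->; rewrite ltxx.
have /(adj u w (neq _ _ (lt_trans uv vw)))[x []] := euw.
rewrite /= !in_itv /= => /andP[_ xru] /andP[lwx _].
have lwru := le_trans lwx xru.
apply/andP; split.
  apply/(adj u v (neq _ _ uv)); exists (l v); split; rewrite /= in_itv /= ?lexx ?lr //.
  by rewrite (ltW uv) (le_trans (ltW vw) lwru).
apply/(adj v w (neq _ _ vw)); exists (l w); split; rewrite /= in_itv /= ?lexx ?lr //.
by rewrite (ltW vw) (le_trans lwru (ltW (rmono _ _ uv))).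
Qed.

(** * Program logic *)

Section Logic.
Variable W : nat.

(** Total correctness; the postcondition also receives the cost, so running time and result are
    proved together. *)
Definition run (p : program) (s : state) (Q : nat -> state -> Prop) : Prop :=
  exists t s', exec W p s t s' /\ Q t s'.

Lemma run_conseq p s (Q Q' : nat -> state -> Prop) :
  (forall t s', Q t s' -> Q' t s') -> run p s Q -> run p s Q'.
Proof. by move=> QQ' [t [s' [ps /QQ' Qs]]]; exists t, s'. Qed.

Lemma run_skip s (Q : nat -> state -> Prop) : Q 1 s -> run Skip s Q.
Proof. by move=> Qs; exists 1, s; split=> //; constructor. Qed.

Lemma run_assign x y s (Q : nat -> state -> Prop) : expr_fits W s y ->
  Q (expr_cost y).+1 (set_var s x (eval s y)) -> run (Assign x y) s Q.
Proof. by move=> fy Qs; do 2 eexists; split; [constructor|]. Qed.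

Lemma run_put a i y s (Q : nat -> state -> Prop) :
  expr_fits W s i -> expr_fits W s y ->
  Q (expr_cost i + expr_cost y).+1 (set_arr s a (eval s i) (eval s y)) ->
  run (Put a i y) s Q.
Proof. by move=> fi fy Qs; do 2 eexists; split; [constructor|]. Qed.

Lemma run_seq p q s (Q : nat -> state -> Prop) :
  run p s (fun t s1 => run q s1 (fun t1 s2 => Q (t + t1) s2)) ->
  run (Seq p q) s Q.
Proof.
move=> [t [s1 [ps [t1 [s2 [qs Qs]]]]]].
by do 2 eexists; split; [apply: ExecSeq ps qs|].
Qed.

Lemma run_if b p q s (Q : nat -> state -> Prop) : test_fits W s b ->
  (teval s b -> run p s (fun t s' => Q (test_cost b + t).+1 s')) ->
  (~~ teval s b -> run q s (fun t s' => Q (test_cost b + t).+1 s')) ->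
  run (If b p q) s Q.
Proof.
move=> fb Hp Hq; have [bs|bs] := boolP (teval s b).
  by have [t [s' [ps Qs]]] := Hp bs; exists (test_cost b + t).+1, s'; split=> //; apply: ExecIfTrue.
by have [t [s' [qs Qs]]] := Hq bs; exists (test_cost b + t).+1, s'; split=> //; apply: ExecIfFalse.
Qed.

(* [I f s] says that the remaining iterations may spend [f] time units. *)
Lemma run_while (I : nat -> state -> Prop) b p f s (Q : nat -> state -> Prop) :
  I f s ->
  (forall f s, I f s -> test_fits W s b) ->
  (forall f s, I f s -> teval s b -> run p s (fun t s' =>
     exists2 f', I f' s' & f' + (test_cost b + t).+1 <= f)) ->
  (forall f' s' t, I f' s' -> ~~ teval s' b ->
     t + f' <= f + (test_cost b).+1 -> Q t s') ->
  run (While b p) s Q.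
Proof.
move=> Is fits body; move: s Is Q; elim/ltn_ind: f => f IHf s Is Q post.
have [bs|bs] := boolP (teval s b); last first.
  exists (test_cost b).+1, s; split; first by constructor; rewrite ?(fits f).
  by apply: (post f s) => //; rewrite addnC.
have [t [s1 [ps [f1 Is1 le_f]]]] := body f s Is bs.
have lt_f : f1 < f by lia.
case: (IHf f1 lt_f s1 Is1 (fun t1 => Q (test_cost b + t + t1).+1)) => [|t1 [s2 [ws Qs]]].
  move=> f' s' t' Is' bs' le_t; apply: (post f' s') => //; lia.
exists (test_cost b + t + t1).+1, s2; split=> //.
by apply: ExecWhileTrue ps ws; rewrite ?(fits f).
Qed.

Fixpoint keeps_var (x : nat) (p : program) : bool :=
  match p with
  | Skip | Put _ _ _ => true
  | Assign y _ => x != y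
  | Seq p q | If _ p q => keeps_var x p && keeps_var x q
  | While _ p => keeps_var x p
  end.

Fixpoint keeps_arr (a : nat) (p : program) : bool :=
  match p with
  | Skip | Assign _ _ => true
  | Put b _ _ => a != b
  | Seq p q | If _ p q => keeps_arr a p && keeps_arr a q
  | While _ p => keeps_arr a p
  end.

(** Whatever [p] does not syntactically write is unchanged; such facts are settled by computation
    and need not enter the loop invariants. *)
Definition framed (p : program) (s s' : state) : Prop :=
  (forall x, keeps_var x p -> var s' x = var s x) /\
  (forall a, keeps_arr a p -> arr s' a = arr s a).

Lemma exec_framed p s t s' : exec W p s t s' -> framed p s s'.
Proof.
elim=> {p s t s'} //=.
- by move=> x y s _; split=> // z /= /negbTE->.
- by move=> a i y s _ _; split=> // b /= /negbTE->.
- move=> p q s t s1 t1 s2 _ [v1 a1] _ [v2 a2]; split=> x /andP[xp xq].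
    by rewrite v2 ?v1.
  by rewrite a2 ?a1.
- by move=> b p q s t s1 _ _ _ [v1 a1]; split=> x /andP[xp xq]; [apply: v1|apply: a1].
- by move=> b p q s t s1 _ _ _ [v1 a1]; split=> x /andP[xp xq]; [apply: v1|apply: a1].
- move=> b p s t s1 t1 s2 _ _ _ [v1 a1] _ [v2 a2]; split=> x xp.
    by rewrite v2 ?v1.
  by rewrite a2 ?a1.
Qed.

Lemma run_framed p s Q :
  run p s Q -> run p s (fun t s' => Q t s' /\ framed p s s').
Proof.
by move=> [t [s' [ps Qs]]]; exists t, s'; split=> //; split=> //; apply: exec_framed ps.
Qed.

End Logic.

(** * Invariant of the breadth-first search *)

Section Search.
Variables (T : finType) (e : rel T) (adj : T -> seq T).
Hypothesis adj_uniq : forall u, uniq (adj u).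
Hypothesis adjE : forall u v, (v \in adj u) = e u v.

Lemma size_adj u : size (adj u) = degree e u.
Proof.
rewrite -(card_uniqP (adj_uniq u)); apply: eq_card => v.
by rewrite inE adjE.
Qed.

(* The state of the search from [z] in the middle of level [k]: the queue [qs]
   also holds the set [D] found by the earlier searches, the level lies between
   [lo] and [hi], and [i] is the next position to be treated. *)
Record searching (D : {set T}) (z : T) (k i lo hi : nat) (qs : seq T) : Prop :=
  Searching {
    search_uniq : uniq qs;
    search_lo : #|D| <= lo <= i;
    search_hi : i <= hi <= size qs;
    search_lt : lo < hi;
    search_before : forall v, (v \in take lo qs) = (v \in D) || (v \in before e z k);
    search_level : forall v, (v \in take hi qs) = (v \in D) || (v \in before e z k.+1);
    search_found : forall v, (v \in qs) =
      (v \in take hi qs) || [exists u in drop lo (take i qs), e u v]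
  }.

Section Component.
Variables (D : {set T}) (z : T).
Hypotheses (D_closed : closed e D) (zD : z \notin D).

Lemma before_notin_found k v : v \in before e z k -> v \notin D.
Proof.
have clD : closed e (~: D) by move=> u w euw; rewrite !inE (D_closed euw).
have zC : z \in ~: D by rewrite inE.
by move=> /(subsetP (before_sub_closed k clD zC)); rewrite inE.
Qed.

Lemma level_notin_found k v : v \in level e z k -> v \notin D.
Proof. by move=> vk; apply: (@before_notin_found k.+1); rewrite beforeS inE vk orbT. Qed.

Lemma mem_take_drop (qs : seq T) lo hi v : uniq qs -> lo <= hi ->
  (v \in drop lo (take hi qs)) = (v \in take hi qs) && (v \notin take lo qs).
Proof.
move=> uq lohi; have E := cat_take_drop lo (take hi qs).
rewrite take_takel // in E.
have -> : (v \in take hi qs) = (v \in take lo qs) || (v \in drop lo (take hi qs)).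
  by rewrite -mem_cat E.
have U := take_uniq hi uq; rewrite -E in U; move: U; rewrite cat_uniq => /and3P[_ /hasPn disj _].
have [vd|_] := boolP (v \in drop _ _).
  by rewrite (negbTE (disj _ vd)) orbT.
by rewrite orbF andbN.
Qed.

Lemma searching_level k i lo hi qs v : searching D z k i lo hi qs ->
  (v \in drop lo (take hi qs)) = (v \in level e z k).
Proof.
move=> S; rewrite mem_take_drop ?(search_uniq S) //; last exact: ltnW (search_lt S).
rewrite (search_level S) (search_before S) beforeS inE.
have [vk|] := boolP (v \in level e z k).
  by rewrite (negbTE (level_notin_found vk)) (negbTE (in_before_level vk)).
by case: (v \in D); case: (v \in before _ _ _).
Qed.

Lemma searching_start qs : uniq qs -> qs =i D ->
  searching D z 0 (size qs) (size qs) (size qs).+1 (rcons qs z).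
Proof.
move=> uq qD.
have sD : size qs = #|D| by rewrite -(card_uniqP uq); apply: eq_card.
have tq : take (size qs) (rcons qs z) = qs.
  by rewrite -cats1 take_size_cat.
have tq1 : take (size qs).+1 (rcons qs z) = rcons qs z.
  by rewrite take_oversize // size_rcons.
split; rewrite ?size_rcons ?sD ?leqnn ?leqnSn -?sD ?tq ?tq1 //.
- by rewrite rcons_uniq uq qD zD.
- by move=> v; rewrite before0 in_set0 orbF qD.
- by move=> v; rewrite beforeS before0 level0 set0U inE mem_rcons inE qD orbC.
move=> v; rewrite drop_size; case: existsP => [[u]|_]; last by rewrite orbF.
by rewrite in_nil.
Qed.

(** Once the whole level has been treated, the entries after it are exactly the unfound neighbours
    of the level, which form the next one. *)
Lemma searching_next k lo hi qs : hi < size qs ->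
  searching D z k hi lo hi qs -> searching D z k.+1 hi hi (size qs) qs.
Proof.
move=> hiq S; have [uq loD hiS lohi bef lev found] := S.
split; rewrite ?take_size //.
- by rewrite leqnn andbT; lia.
- by rewrite ltnW // leqnn.
- move=> v; rewrite found lev [before e z k.+2]beforeS in_setU -orbA.
  congr (_ || _).
  have eqE : [exists u in drop lo (take hi qs), e u v] =
             [exists u in level e z k, e u v].
    by apply: eq_existsb => u; rewrite (searching_level _ S).
  rewrite eqE; apply/orP/orP => -[H|H]; auto.
    have [vB|vB] := boolP (v \in before e z k.+1); first by left.
    by right; apply/levelSP; split=> //; apply/exists_inP.
  by right; case/levelSP: H => _ /exists_inP.
move=> v; rewrite drop_oversize; last by rewrite size_take; case: ifP => // /negbT; lia.
by case: existsP => [[u]|_]; rewrite ?in_nil // orbF.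
Qed.

Lemma searching_visit k i lo hi qs v : i < hi -> ohead (drop i qs) = Some v ->
  searching D z k i lo hi qs ->
  searching D z k i.+1 lo hi (qs ++ [seq w <- adj v | w \notin qs]).
Proof.
move=> ihi iv [uq loD /andP[_ hiS] lohi bef lev found].
have iq : i < size qs := leq_trans ihi hiS.
have vE : nth v qs i = v by move: iv; rewrite (drop_nth v iq) /= => -[].
have tcat j : j <= size qs -> take j (qs ++ [seq w <- adj v | w \notin qs]) = take j qs.
  by move=> jS; rewrite take_cat; case: ltngtP jS => // -> _; rewrite subnn take0 cats0 take_size.
have loq : lo <= size qs by lia.
have tE : drop lo (take i.+1 qs) = rcons (drop lo (take i qs)) v.
  rewrite (take_nth v iq) vE drop_rcons //.
  by rewrite size_take iq; case/andP: loD.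
split; rewrite ?size_cat ?tcat //.
- rewrite cat_uniq uq filter_uniq // andbT; apply/hasPn => w.
  by rewrite mem_filter => /andP[].
- by case/andP: loD => -> /leqW.
- by rewrite ihi (leq_trans hiS) ?leq_addr.
move=> w; rewrite tE mem_cat mem_filter adjE.
have -> : [exists u in rcons (drop lo (take i qs)) v, e u w] =
          e v w || [exists u in drop lo (take i qs), e u w].
  apply/exists_inP/orP => [[u]|[evw|/exists_inP[u uq' euw]]].
  - rewrite mem_rcons inE => /orP[/eqP->|uq' euw]; first by left.
    by right; apply/exists_inP; exists u.
  - by exists v; rewrite // mem_rcons mem_head.
  - by exists u; rewrite // mem_rcons inE uq' orbT.
rewrite orbCA -found; by case: (e v w); case: (w \in qs).
Qed.

Lemma searching_end k lo hi qs : size qs = hi -> searching D z k hi lo hi qs ->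
  level e z k.+1 = set0 /\ forall v, (v \in qs) = (v \in D) || (v \in before e z k.+1).
Proof.
move=> qhi S; have found := search_found S; have lev := search_level S.
have tq : take hi qs = qs by rewrite -qhi take_size.
split=> [|v]; last by rewrite -lev tq.
apply/setP => v; rewrite in_set0; apply/negP => /[dup] vk' /levelSP[vB [u uk euv]].
have : v \in qs.
  rewrite found; apply/orP; right; apply/exists_inP; exists u => //.
  by rewrite (searching_level _ S).
by rewrite -{1}tq lev (negbTE vB) orbF (negbTE (level_notin_found vk')).
Qed.

(** The first [lo] entries list [D] and the earlier levels. As [D] is closed, no neighbour of [v] is
    in it, so subtracting the counted neighbours gives the left end of [layers_placed] with
    [b = #|D|]. *)
Lemma searching_left k i lo hi qs v : searching D z k i lo hi qs ->
  v \in level e z k ->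
  lo - count (mem (take lo qs)) (adj v) = #|D| + #|before e z k :\: [set u | e v u]|.
Proof.
move=> S vk; have [uq /andP[Dlo loi] hiS lohi bef lev found] := S.
have dis : D :&: before e z k = set0.
  apply/setP => u; rewrite !inE; apply/andP => -[uD /before_notin_found].
  by rewrite uD.
have loE : lo = #|D| + #|before e z k|.
  have <- : size (take lo qs) = lo by rewrite size_takel //; lia.
  rewrite -(card_uniqP (take_uniq lo uq)) -[RHS]subn0 -(cards0 T) -dis -cardsU.
  by apply: eq_card => u; rewrite !inE -bef.
have -> : count (mem (take lo qs)) (adj v) = #|before e z k :&: [set u | e v u]|.
  rewrite -size_filter -(card_uniqP (filter_uniq _ (adj_uniq v))).
  apply: eq_card => u; rewrite mem_filter /= bef adjE !inE.
  have [evu|] := boolP (e v u); rewrite ?andbF // !andbT.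
  by rewrite -(D_closed evu) (negbTE (level_notin_found vk)).
by rewrite cardsD loE addnBA // subset_leq_card // subsetIl.
Qed.

End Component.

End Search.

(** * The program *)

(* Variables: 3 number of vertices found by the earlier searches, 4 source of
   the search and later the vertex of least degree in the current level,
   5 length of the queue, 6 position in the queue, 7 and 8 bounds of the
   current level, 13 least degree in it, 9 current vertex, 14 its degree,
   10 and 15 bounds of the rest of its adjacency list, 11 current neighbour,
   12 left end of the neighbourhood of the current vertex.
   Arrays: P holds 1 + position in the queue (0 for the vertices not yet
   found), Q the queue, A the number of neighbourhoods by left end. *)
Definition scan (P Q : nat) : program :=
  While (Lt (Var 10) (Var 15))
   (Seq (Assign 11 (Get 1 (Var 10)))
   (Seq (If (Eq (Get P (Var 11)) (Lit 0))
          (Seq (Put P (Var 11) (Add (Var 5) (Lit 1)))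
          (Seq (Put Q (Var 5) (Var 11))
               (Assign 5 (Add (Var 5) (Lit 1)))))
          (If (Lt (Get P (Var 11)) (Add (Var 7) (Lit 1)))
             (Assign 12 (Defs.Sub (Var 12) (Lit 1))) Skip))
        (Assign 10 (Add (Var 10) (Lit 1))))).

(** At the end of a level the rest of the queue is the next level. The least degree is reset to the
    number of vertices, which exceeds every degree. *)
Definition enter_level : program :=
  If (Eq (Var 6) (Var 8))
    (Seq (Assign 7 (Var 8)) (Seq (Assign 8 (Var 5)) (Assign 13 (Var 0)))) Skip.

Definition visit (P Q A : nat) : program :=
  Seq enter_level
  (Seq (Assign 9 (Get Q (Var 6)))
  (Seq (Assign 12 (Var 7))
  (Seq (Assign 10 (Get 0 (Var 9)))
  (Seq (Assign 15 (Get 0 (Add (Var 9) (Lit 1))))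
  (Seq (Assign 14 (Defs.Sub (Var 15) (Var 10)))
  (Seq (scan P Q)
  (Seq (Put A (Var 12) (Add (Get A (Var 12)) (Lit 1)))
  (Seq (If (Lt (Var 14) (Var 13))
          (Seq (Assign 13 (Var 14)) (Assign 4 (Var 9))) Skip)
       (Assign 6 (Add (Var 6) (Lit 1))))))))))).

Definition bfs (P Q A : nat) : program :=
  Seq (Assign 6 (Var 3))
  (Seq (Assign 7 (Var 3))
  (Seq (Put P (Var 4) (Add (Var 3) (Lit 1)))
  (Seq (Put Q (Var 3) (Var 4))
  (Seq (Assign 5 (Add (Var 3) (Lit 1)))
  (Seq (Assign 8 (Var 5))
  (Seq (Assign 13 (Var 0))
       (While (Lt (Var 6) (Var 5)) (visit P Q A)))))))).

(** Each component is searched twice with separate arrays; the first search leaves in variable 4 the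
    source of the second. Variable 3 advances only after both. *)
Definition order_vertices : program :=
  While (Lt (Var 2) (Var 0))
    (Seq (If (Eq (Get 2 (Var 2)) (Lit 0))
            (Seq (Assign 4 (Var 2))
            (Seq (bfs 2 3 4) (Seq (bfs 5 6 7) (Assign 3 (Var 5))))) Skip)
         (Assign 2 (Add (Var 2) (Lit 1)))).

(* Variables: 16 number of neighbourhoods whose left end has been passed, 19, 17
   and 18 the three components of [greedy]. *)
Definition choose_cliques : program :=
  Seq (Assign 6 (Lit 0))
  (While (Lt (Var 6) (Var 0))
    (Seq (Assign 16 (Add (Var 16) (Get 7 (Var 6))))
    (Seq (If (And (Lt (Lit 0) (Get 7 (Var 6))) (Not (Lt (Var 6) (Var 17))))
            (Seq (Assign 19 (Add (Var 19) (Lit 1)))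
            (Seq (Assign 17 (Var 18)) (Assign 18 (Add (Var 16) (Lit 1))))) Skip)
         (Assign 6 (Add (Var 6) (Lit 1)))))).

Definition answer : program :=
  If (And (Lt (Lit 0) (Var 0)) (Lt (Var 1) (Add (Var 19) (Lit 1))))
    (Assign 0 (Lit 1)) (Assign 0 (Lit 0)).

Definition uct_program : program :=
  Seq order_vertices (Seq choose_cliques answer).

Lemma uniq_size_ord n (q : seq 'I_n) : uniq q -> size q <= n.
Proof. by move=> /card_uniqP <-; rewrite -[leqRHS]card_ord max_card. Qed.

(** * Input layout and adjacency lists *)

Section Inputs.
Variables (n : nat) (adj : 'I_n -> seq 'I_n).

Definition arcs : nat := \sum_(u < n) size (adj u).

Lemma offset0 : offset adj 0 = 0.
Proof. by rewrite /offset big_pred0. Qed.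

Lemma offsetS (v : 'I_n) : offset adj v.+1 = offset adj v + size (adj v).
Proof.
rewrite /offset (bigD1 v) //= addnC; congr (_ + _); apply: eq_bigl => u.
by rewrite ltnS ltn_neqAle andbC.
Qed.

Lemma offset_le i : offset adj i <= arcs.
Proof. by rewrite /offset /arcs [leqRHS](bigID (fun u : 'I_n => u < i)) leq_addr. Qed.

Lemma nth_neighbours (v : 'I_n) j : j < size (adj v) ->
  nth 0 (neighbours adj) (offset adj v + j) = nth v (adj v) j.
Proof.
move=> jv; pose ss := [seq [seq val w | w <- adj u] | u <- enum 'I_n].
have ssS : size ss = n by rewrite size_map size_enum_ord.
have shE (i : 'I_n) : nth 0 (shape ss) i = size (adj i).
  rewrite (nth_map [::]) ?ssS //.
  by rewrite (nth_map i) ?size_enum_ord // nth_ord_enum size_map.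
have offE m : m <= n -> offset adj m = sumn (take m (shape ss)).
  elim: m => [|m IHi]; first by rewrite offset0 take0.
  move=> iv; have shS : m < size (shape ss) by rewrite size_map ssS.
  rewrite (offsetS (Ordinal iv)) /= (take_nth 0 shS).
  by rewrite sumn_rcons -IHi ?(ltnW iv) // (shE (Ordinal iv)).
rewrite offE ?(ltnW (ltn_ord v)) // -[_ + j]/(flatten_index (shape ss) v j).
rewrite /neighbours nth_flatten flatten_indexKl ?flatten_indexKr ?shE //.
rewrite (nth_map v) ?size_enum_ord // nth_ord_enum (nth_map v) //.
Qed.

Definition inputs (s : state) : Prop :=
  [/\ var s 0 = Posz n,
      forall i, i <= n -> arr s 0 (Posz i) = Posz (offset adj i)
    & forall (v : 'I_n) j, j < size (adj v) ->
        arr s 1 (Posz (offset adj v + j)) = Posz (nth v (adj v) j)].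

Lemma input_inputs k : inputs (input adj k).
Proof.
split=> // [i ile|v j jv]; last by rewrite /= nth_neighbours.
rewrite -[LHS]/(Posz (nth 0 [seq offset adj j | j <- iota 0 n.+1] i)).
by rewrite (nth_map 0) ?size_iota ?nth_iota.
Qed.

Lemma framed_inputs p s s' : framed p s s' ->
  keeps_var 0 p && keeps_arr 0 p && keeps_arr 1 p -> inputs s -> inputs s'.
Proof.
move=> [fv fa] /andP[/andP[k0 k1] k2] [i0 i1 i2].
by split; rewrite ?fv ?fa.
Qed.

Variable W : nat.
Hypothesis W_large : 2 * n + arcs + 5 <= W.

Section Arrays.
Variables P Q A : nat.
Hypothesis PQA : uniq [:: 0; 1; P; Q; A].

Lemma arrays_neq : ((P == Q) = false) * ((Q == P) = false) * ((P == A) = false)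
  * ((A == P) = false) * ((Q == A) = false) * ((A == Q) = false)
  * ((0 == P) = false) * ((0 == Q) = false) * ((0 == A) = false)
  * ((1 == P) = false) * ((1 == Q) = false) * ((1 == A) = false).
Proof.
move: PQA; rewrite /= !inE !negb_or -!andbA.
case/and5P=> ? ? ? ? /and5P[? ? ? ? /and3P[? ? ?]].
by rewrite !(eq_sym Q) !(eq_sym A); do !split; apply: negbTE; rewrite // eq_sym.
Qed.

Definition queue (qs : seq 'I_n) (s : state) : Prop :=
  (forall v : 'I_n,
     arr s P (Posz v) = Posz (if v \in qs then (index v qs).+1 else 0)) /\
  (forall (v : 'I_n) i, i < size qs -> arr s Q (Posz i) = Posz (nth v qs i)).

Lemma queue_push qs s (v : 'I_n) : queue qs s -> v \notin qs ->
  queue (rcons qs v) (set_arr (set_arr s P (Posz v) (Posz (size qs) + 1)%R)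
                        Q (Posz (size qs)) (Posz v)).
Proof.
move=> [qP qQ] vq; rewrite -PoszD addn1; split=> [u|u i] /=; rewrite ?arrays_neq eqxx /=.
  rewrite eqz_nat val_eqE mem_rcons inE -cats1 index_cat qP.
  have [->|uv] /= := eqVneq u v; first by rewrite (negbTE vq) /= eqxx addn0.
  by case: ifP.
rewrite size_rcons ltnS eqz_nat nth_rcons => iq.
by case: ltngtP iq => // iq _; apply: qQ.
Qed.

(** After [m] neighbours, everything is expressed by the queue [qs] at the start of the scan;
    filtering against [qs] alone suffices for duplicate-free lists. *)
Record scanning (lo : nat) (v : 'I_n) (qs : seq 'I_n) (m : nat) (s : state)
    : Prop := Scanning {
  scan_inputs : inputs s;
  scan_queue : queue (qs ++ [seq w <- take m (adj v) | w \notin qs]) s;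
  scan_le : m <= size (adj v);
  scan5 : var s 5 = Posz (size (qs ++ [seq w <- take m (adj v) | w \notin qs]));
  scan7 : var s 7 = Posz lo;
  scan10 : var s 10 = Posz (offset adj v + m);
  scan12 : var s 12 = Posz (lo - count (mem (take lo qs)) (take m (adj v)));
  scan15 : var s 15 = Posz (offset adj v.+1)
}.

Lemma run_scan lo v (qs : seq 'I_n) s : uniq qs -> uniq (adj v) -> lo <= size qs ->
  scanning lo v qs 0 s ->
  run W (scan P Q) s (fun t s' =>
    t <= 30 * size (adj v) + 4 /\ scanning lo v qs (size (adj v)) s').
Proof.
move=> uq ua loq S0.
(* At most 26 units for the body and 4 for the loop test make 30 per neighbour. *)
pose I f s' := exists2 m, f = 30 * (size (adj v) - m) & scanning lo v qs m s'.
apply: (@run_while W I _ _ (30 * size (adj v))).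
- by exists 0; rewrite ?subn0.
- move=> f s1 [m _ [inp q mv v5 v7 v10 v12 v15]] /=.
  rewrite v10 v15; have := offset_le v.+1; have := offsetS v; lia.
- move=> f s1 [m fE S] /=; have [inp q mv v5 v7 v10 v12 v15] := S.
  rewrite v10 v15 offsetS => mlt; have {}mlt : m < size (adj v) by lia.
  set w := nth v (adj v) m.
  have wE : arr s1 1 (Posz (offset adj v + m)) = Posz w by case: inp => _ _; apply.
  have tE : take m.+1 (adj v) = rcons (take m (adj v)) w by rewrite (take_nth v).
  have wt : w \notin take m (adj v).
    have := take_uniq m.+1 ua; rewrite tE rcons_uniq; by case/andP.
  set q0 := qs ++ _ in q v5.
  have q0E : q0 = qs ++ [seq u <- take m (adj v) | u \notin qs] by [].
  have wq : (w \in q0) = (w \in qs).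
    by rewrite mem_cat mem_filter (negbTE wt) andbF orbF.
  have q0n : size q0 <= n.
    apply: uniq_size_ord; rewrite cat_uniq uq filter_uniq ?take_uniq //=.
    by rewrite andbT; apply/hasPn => u; rewrite mem_filter => /andP[].
  (* The counted neighbours are distinct members of the first [lo] entries, so the truncated
     subtraction agrees with the decrements. *)
  have cnt_lo : count (mem (take lo qs)) (take m.+1 (adj v)) <= lo.
    rewrite -size_filter -[leqRHS](size_takel loq); apply: uniq_leq_size.
      by rewrite filter_uniq ?take_uniq.
    by move=> u; rewrite mem_filter => /andP[].
  have qE : qs ++ [seq u <- take m.+1 (adj v) | u \notin qs] =
      if w \in qs then q0 else rcons q0 w.
    by rewrite tE filter_rcons; case: (w \in qs); rewrite //= -rcons_cat.
  have cE : count (mem (take lo qs)) (take m.+1 (adj v)) =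
      count (mem (take lo qs)) (take m (adj v)) + (w \in take lo qs).
    by rewrite tE -cats1 count_cat /= addn0.
  have [qP _] := q; have Pw := qP w; rewrite wq in Pw.
  have q1 : w \notin qs -> size (rcons q0 w) <= n.
    move=> wn; apply: uniq_size_ord; rewrite rcons_uniq wq wn /=.
    rewrite cat_uniq uq filter_uniq ?take_uniq //=.
    by rewrite andbT; apply/hasPn => u; rewrite mem_filter => /andP[].
  have wn := ltn_ord w.
  clearbody w q0.
  have offm : offset adj v + m < arcs by have := offset_le v.+1; rewrite offsetS; lia.
  suff H : run W (Seq (Assign 11 (Get 1 (Var 10)))
   (Seq (If (Eq (Get P (Var 11)) (Lit 0))
          (Seq (Put P (Var 11) (Add (Var 5) (Lit 1)))
          (Seq (Put Q (Var 5) (Var 11))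
               (Assign 5 (Add (Var 5) (Lit 1)))))
          (If (Lt (Get P (Var 11)) (Add (Var 7) (Lit 1)))
             (Assign 12 (Defs.Sub (Var 12) (Lit 1))) Skip))
        (Assign 10 (Add (Var 10) (Lit 1))))) s1 (fun t s' => [/\ t <= 26,
      queue (qs ++ [seq u <- take m.+1 (adj v) | u \notin qs]) s',
      var s' 5 = Posz (size (qs ++ [seq u <- take m.+1 (adj v) | u \notin qs])),
      var s' 10 = Posz (offset adj v + m.+1) &
      var s' 12 = Posz (lo - count (mem (take lo qs)) (take m.+1 (adj v)))]).
    apply: run_conseq (run_framed H) => t s2 [[tle q2 w5 w10 w12] fr].
    exists (30 * (size (adj v) - m.+1)); last by lia.
    exists m.+1 => //; have [fv _] := fr.
    split=> //; rewrite ?fv //.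
    by apply: framed_inputs fr _ inp; rewrite /= !arrays_neq.
  rewrite qE; apply: run_seq; apply: run_assign; rewrite /= v10 wE; first by lia.
  apply: run_seq; apply: run_if.
  - rewrite /= Pw; case: ifP => wqs; rewrite /=; last by lia.
    have : index w q0 < size q0 by rewrite index_mem wq.
    lia.
  - rewrite /= Pw; case: ifP => //= wqs _.
    have szq : size q0 < n by rewrite -(size_rcons q0 w) q1 ?wqs.
    apply: run_seq; apply: run_put; [rewrite /=; lia|rewrite /= v5; lia|rewrite /= v5].
    apply: run_seq; apply: run_put; [rewrite /= v5; lia|rewrite /=; lia|rewrite /= v5].
    apply: run_assign; [rewrite /= v5; lia|rewrite /= v5].
    apply: run_assign; [rewrite /= v10; lia|rewrite /= v10].
    rewrite size_rcons v12 cE; split=> //.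
    + by apply: (queue_push (s := s1) q); rewrite wq wqs.
    + by lia.
    + by lia.
    + have -> : (w \in take lo qs) = false; last by rewrite addn0.
      by apply: contraFF wqs; apply: mem_take.
  - rewrite /= Pw; case: ifP => //= wqs _.
    rewrite wqs in Pw.
    have idx : index w q0 < size q0 by rewrite index_mem wq.
    have lon : lo <= n := leq_trans loq (uniq_size_ord uq).
    (* Array [P] stores one plus the position, so the test against [lo + 1] recognises the first
       [lo] entries. *)
    have wlo : (w \in take lo qs) = (index w q0 < lo).
      by rewrite in_take // q0E index_cat wqs.
    apply: run_if; first by rewrite /= Pw v7; lia.
    + rewrite /= Pw v7 => wl; have {}wl : index w q0 < lo by lia.
      rewrite cE wlo wl -[nat_of_bool true]/1 in cnt_lo *.
      apply: run_assign; [rewrite /= v12; lia|rewrite /= v12].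
      apply: run_assign; [rewrite /= v10; lia|rewrite /= v10].
      split=> //; try lia.
      by move: cnt_lo; move: (count _ _) => cnt; lia.
    + rewrite /= Pw v7 => wl; have {}wl : (index w q0 < lo) = false by lia.
      rewrite cE wlo wl addn0.
      apply: run_skip; apply: run_assign; [rewrite /= v10; lia|rewrite /= v10].
      by split=> //; lia.
move=> f s1 t [m fE S] /= + le_t; have [inp q mv v5 v7 v10 v12 v15] := S.
rewrite v10 v15 offsetS => mlt; have mE : m = size (adj v) by lia.
by split; [lia|rewrite -mE].
Qed.

Variable e : rel 'I_n.
Hypothesis e_sym : symmetric e.
Hypothesis e_irr : irreflexive e.
Hypothesis adj_uniq : forall u, uniq (adj u).
Hypothesis adjE : forall u v, (v \in adj u) = e u v.

Lemma size_adj_lt v : size (adj v) < n.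
Proof.
have : uniq (v :: adj v) by rewrite /= adjE e_irr adj_uniq.
by move/uniq_size_ord.
Qed.

(** * Correctness and cost of one search *)

Section Component.
Variables (D : {set 'I_n}) (z0 : 'I_n) (Lf : 'I_n -> nat).
Hypotheses (D_closed : closed e D) (zD : z0 \notin D).
Hypothesis LfE : forall k u, u \in level e z0 k ->
  Lf u = #|D| + #|before e z0 k :\: [set w | e u w]|.

(** [best] is the least degree among the treated vertices of the current level, with value [n]
    possible while there are none; array [A] counts left ends over all treated vertices, those of
    [D] included. *)
Record visiting (k i lo hi : nat) (qs : seq 'I_n) (best : nat) (z : 'I_n)
    (s : state) : Prop := Visiting {
  visit_inputs : inputs s;
  visit_queue : queue qs s;
  visit_search : searching e D z0 k i lo hi qs;
  visit4 : var s 4 = Posz z;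
  visit5 : var s 5 = Posz (size qs);
  visit6 : var s 6 = Posz i;
  visit7 : var s 7 = Posz lo;
  visit8 : var s 8 = Posz hi;
  visit13 : var s 13 = Posz best;
  visit_best : forall u, u \in drop lo (take i qs) -> best <= size (adj u);
  visit_at : best = n \/ z \in drop lo (take i qs) /\ size (adj z) = best;
  visit_count : forall x : nat,
    arr s A (Posz x) = Posz #|[set u in take i qs | Lf u == x]|
}.

Lemma visiting_bounds k i lo hi qs best z s : visiting k i lo hi qs best z s ->
  [/\ #|D| <= lo, lo <= i, i <= hi, hi <= size qs & size qs <= n].
Proof.
move=> V; have S := visit_search V.
have /andP[? ?] := search_lo S; have /andP[? ?] := search_hi S.
by split=> //; apply: uniq_size_ord (search_uniq S).
Qed.

Lemma run_enter k i lo hi qs best z s : visiting k i lo hi qs best z s ->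
  i < size qs -> run W enter_level s (fun t s' => t <= 15 /\
    exists k' lo' hi' best', visiting k' i lo' hi' qs best' z s' /\ i < hi').
Proof.
move=> V iq; have [inp q S v4 v5 v6 v7 v8 v13 bst at_ cnt] := V.
have [_ _ ihi hiq qn] := visiting_bounds V.
apply: run_if; rewrite /= ?v6 ?v8; first by lia.
  move=> /eqP[hiE]; subst hi.
  apply: run_seq; apply: run_assign; rewrite /= v8; first by lia.
  apply: run_seq; apply: run_assign; rewrite /= v5; first by lia.
  have v0 : var s 0 = Posz n by case: inp.
  apply: run_assign; rewrite /= v0; first by lia.
  split=> //; exists k.+1, i, (size qs), n; split=> //; split=> //.
  - exact: searching_next S.
  - by rewrite drop_oversize // size_take iq.
  - by left.
move=> ihi'; apply: run_skip; split=> //.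
by exists k, lo, hi, best; split=> //; lia.
Qed.

Lemma run_visit k i lo hi qs best z v s : visiting k i lo hi qs best z s ->
  ohead (drop i qs) = Some v ->
  run W (visit P Q A) s (fun t s' => t <= 30 * size (adj v) + 100 /\
    exists k' lo' hi' qs' best' z', visiting k' i.+1 lo' hi' qs' best' z' s' /\
      take i.+1 qs' = rcons (take i qs) v).
Proof.
move=> V0 iv.
have iq : i < size qs.
  by rewrite ltnNge; apply/negP => /drop_oversize qE; rewrite qE in iv.
have vE u : nth u qs i = v by move: iv; rewrite (drop_nth u iq) /= => -[].
apply: run_seq; apply: run_conseq (run_enter V0 iq).
move=> t s1 [tle {k lo hi best V0}[k [lo [hi [best [V ihi]]]]]].
have [inp q S v4 v5 v6 v7 v8 v13 bst at_ cnt] := V.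
have uq := search_uniq S; have [Dlo loi _ hiq qn] := visiting_bounds V.
have [i0 i1 i2] := inp; have vn := ltn_ord v; have dvn := size_adj_lt v.
have offv := offset_le v; have offv1 := offset_le v.+1.
have vq : v \in qs by rewrite -(vE v) mem_nth.
have idx : index v qs = i by rewrite -{1}(vE v) index_uniq.
have subE : (Posz (offset adj v.+1) - Posz (offset adj v))%R = Posz (size (adj v)).
  by rewrite offsetS; lia.
have Qi : arr s1 Q (Posz i) = Posz v by case: q => _ /(_ v i iq) ->; rewrite vE.
apply: run_seq; apply: run_assign; rewrite /= v6 Qi; first by lia.
apply: run_seq; apply: run_assign; rewrite /= v7; first by lia.
have a0 : arr s1 0 (Posz v) = Posz (offset adj v) by apply: i1; lia.
have a1 : arr s1 0 (Posz v + 1)%R = Posz (offset adj v.+1).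
  by rewrite -PoszD addn1; apply: i1.
apply: run_seq; apply: run_assign; rewrite /= a0; first by lia.
apply: run_seq; apply: run_assign; rewrite /= a1; first by lia.
apply: run_seq; apply: run_assign; rewrite /= subE; first by lia.
set s2 := set_var _ 14 _.
have scan0 : scanning lo v qs 0 s2.
  by split; rewrite ?take0 /= ?cats0 ?addn0 ?subn0 //; case: inp => *; split.
apply: run_seq; apply: run_conseq (run_framed (run_scan uq (adj_uniq v) _ scan0)).
  move=> t1 s3 [[t1le [inp3 q3 _ w5 w7 _ w12 _]] [fv fa]].
  rewrite take_size in q3 w5 w12; set qs' := qs ++ _ in q3 w5.
  (* Position [i] lies in the segment of level [k], so [searching_left] identifies the final value
     of variable 12 with the left end of [v]. *)
  have vk : v \in level e z0 k.
    rewrite -(searching_level D_closed zD v S) mem_take_drop //; last by lia.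
    by rewrite !in_take // idx ihi -leqNgt.
  have leftE := searching_left adj_uniq adjE D_closed zD S vk.
  rewrite -(LfE vk) in leftE; rewrite leftE in w12.
  have LfM : Lf v <= n by rewrite -leftE; lia.
  have w4 : var s3 4 = Posz z by rewrite fv.
  have w6 : var s3 6 = Posz i by rewrite fv.
  have w8 : var s3 8 = Posz hi by rewrite fv.
  have w9 : var s3 9 = Posz v by rewrite fv.
  have w13 : var s3 13 = Posz best by rewrite fv.
  have w14 : var s3 14 = Posz (size (adj v)) by rewrite fv.
  have wA x : arr s3 A (Posz x) = Posz #|[set u in take i qs | Lf u == x]|.
    by rewrite fa /= ?arrays_neq //= ?[A == P]eq_sym ?arrays_neq // -cnt.
  have cntS (x : nat) : #|[set u in rcons (take i qs) v | Lf u == x]| =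
      #|[set u in take i qs | Lf u == x]| + (x == Lf v).
    rewrite eq_sym; case: eqP => [vx|vx].
      rewrite addn1 -add1n -[1]/(nat_of_bool true).
      have <- : (v \notin [set u in take i qs | Lf u == x]) = true.
        by rewrite inE in_take // idx ltnn.
      rewrite -cardsU1; apply: eq_card => u; rewrite !inE mem_rcons inE.
      by have [->|] := eqVneq u v; rewrite //= vx eqxx.
    rewrite addn0; apply: eq_card => u; rewrite !inE mem_rcons inE.
    by have [->|] := eqVneq u v; rewrite //= (introF eqP vx) !andbF.
  have qS := searching_visit adj_uniq adjE zD ihi iv S.
  have tE : take i.+1 qs' = rcons (take i qs) v.
    by rewrite takel_cat // (take_nth v) // vE.
  have dE : drop lo (take i.+1 qs') = rcons (drop lo (take i qs)) v.
    by rewrite tE drop_rcons // size_take iq.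
  have cM (x : nat) : #|[set u in take i qs | Lf u == x]| <= n.
    by rewrite -[leqRHS]card_ord max_card.
  apply: run_seq; apply: run_put; rewrite /= ?w12 ?wA; [lia|have := cM (Lf v); lia|].
  set s4 := set_arr _ _ _ _.
  have fin best' (z' : 'I_n) s5 : arr s5 = arr s4 -> var s5 0 = Posz n ->
      var s5 4 = Posz z' -> var s5 5 = Posz (size qs') -> var s5 6 = Posz i.+1 ->
      var s5 7 = Posz lo -> var s5 8 = Posz hi -> var s5 13 = Posz best' ->
      (forall u, u \in drop lo (take i.+1 qs') -> best' <= size (adj u)) ->
      (best' = n \/ z' \in drop lo (take i.+1 qs') /\ size (adj z') = best') ->
      visiting k i.+1 lo hi qs' best' z' s5.
    move=> aE x0 x4 x5 x6 x7 x8 x13 xb xa; split=> //.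
    - by case: inp3 => *; split; rewrite ?aE /= ?arrays_neq.
    - by case: q3 => *; split; rewrite aE /= ?arrays_neq.
    - move=> x; rewrite aE /= eqxx wA eqz_nat tE cntS.
      by case: eqP => [->|_]; rewrite ?addn0 -?PoszD.
  have w0 : var s3 0 = Posz n by case: inp3.
  have bestn : best <= n by case: at_ => [->//|[_ <-]]; apply/ltnW/size_adj_lt.
  apply: run_seq; apply: run_if; rewrite /= ?w14 ?w13; first by lia.
    move=> lt_best; apply: run_seq; apply: run_assign; rewrite /= w14; first by lia.
    apply: run_assign; rewrite /= w9; first by lia.
    apply: run_assign; rewrite /= w6; first by lia.
    split; first by lia.
    exists k, lo, hi, qs', (size (adj v)), v; split=> //.
    apply: fin => //=; rewrite ?w6 ?dE.
    - lia.
    - move=> u; rewrite mem_rcons inE => /orP[/eqP->//|/bst]; lia.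
    - by right; rewrite mem_rcons mem_head.
  move=> ge_best; apply: run_skip.
  apply: run_assign; rewrite /= w6; first by lia.
  split; first by lia.
  exists k, lo, hi, qs', best, z; split=> //.
  apply: fin => //=; rewrite ?w6 ?dE.
  - lia.
  - move=> u; rewrite mem_rcons inE => /orP[/eqP->//|/bst]; lia.
  - case: at_ => [->|[zi zE]]; [by left|right].
    by rewrite mem_rcons inE zi orbT.
lia.
Qed.

Record searched (k : nat) (qs : seq 'I_n) (z : 'I_n) (s : state) : Prop :=
  Searched {
    searched_inputs : inputs s;
    searched_queue : queue qs s;
    searched_uniq : uniq qs;
    searched_last : level e z0 k.+1 = set0;
    searched_mem : forall u, (u \in qs) = (u \in D :|: before e z0 k.+1);
    searched_level : z \in level e z0 k;
    searched_min : forall u, u \in level e z0 k -> size (adj z) <= size (adj u);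
    searched4 : var s 4 = Posz z;
    searched5 : var s 5 = Posz (size qs);
    searched_count : forall x : nat, arr s A (Posz x) =
      Posz #|[set u in D :|: before e z0 k.+1 | Lf u == x]|
  }.

(** A potential that pays for the visits still to come; 110 covers a visit apart from its scan, and
    the loop test. Over successive searches it telescopes. *)
Definition todo (qs : seq 'I_n) : nat :=
  \sum_(u | u \notin qs) (30 * size (adj u) + 110).

Lemma todo_rcons qs v : v \notin qs ->
  todo qs = 30 * size (adj v) + 110 + todo (rcons qs v).
Proof.
move=> vq; rewrite /todo (bigD1 v) //=; congr (_ + _); apply: eq_bigl => u.
by rewrite mem_rcons inE negb_or andbC.
Qed.

Lemma run_bfs qs s : inputs s -> queue qs s -> uniq qs -> qs =i D ->
  var s 3 = Posz (size qs) -> var s 4 = Posz z0 ->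
  (forall x : nat, arr s A (Posz x) = Posz #|[set u in D | Lf u == x]|) ->
  run W (bfs P Q A) s (fun t s' => exists k qs' z,
    searched k qs' z s' /\ t + todo qs' <= todo qs + 50).
Proof.
move=> inp q uq qD v3 v4 cnt; have [v0 _ _] := inp; have zn := ltn_ord z0.
have zq : z0 \notin qs by rewrite qD.
have uz : uniq (rcons qs z0) by rewrite rcons_uniq zq.
have szn : size qs < n by have := uniq_size_ord uz; rewrite size_rcons.
apply: run_seq; apply: run_assign; rewrite /= v3; first by lia.
apply: run_seq; apply: run_assign; rewrite /= v3; first by lia.
apply: run_seq; apply: run_put; rewrite /= ?v3 ?v4; [lia|lia|].
apply: run_seq; apply: run_put; rewrite /= ?v3 ?v4; [lia|lia|].
apply: run_seq; apply: run_assign; rewrite /= v3; first by lia.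
apply: run_seq; apply: run_assign; rewrite /=; first by lia.
apply: run_seq; apply: run_assign; rewrite /= v0; first by lia.
pose I f s' := exists k i lo hi qs' best z,
  visiting k i lo hi qs' best z s' /\ f = todo (take i qs').
have tq : take (size qs) (rcons qs z0) = qs by rewrite -cats1 take_size_cat.
apply: (@run_while W I _ _ (todo qs)).
- exists 0, (size qs), (size qs), (size qs).+1, (rcons qs z0), n, z0.
  rewrite tq; split=> //; split=> //=; rewrite ?tq ?size_rcons; try by [|lia].
  + by case: inp => *; split; rewrite /= ?arrays_neq.
  + by apply: (queue_push (s := s) q).
  + exact: searching_start.
  + by move=> u; rewrite drop_size.
  + move=> x; rewrite !arrays_neq /= cnt; congr Posz; apply: eq_card => u.
    by rewrite !inE qD.
- move=> f s1 [k [i [lo [hi [qs1 [best [z [V _]]]]]]]] /=.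
  have [_ _ ihi hiq qn] := visiting_bounds V.
  rewrite (visit6 V) (visit5 V); lia.
- move=> f s1 [k [i [lo [hi [qs1 [best [z [V ->]]]]]]]] /=.
  rewrite (visit6 V) (visit5 V) => iq; have {}iq : i < size qs1 by lia.
  case iv: (ohead (drop i qs1)) => [v|]; last first.
    by move: iv; rewrite (drop_nth z0 iq).
  apply: run_conseq (run_visit V iv).
  move=> t s2 [tle [k' [lo' [hi' [qs2 [best' [z' [V' tE]]]]]]]].
  exists (todo (take i.+1 qs2)); first by exists k', i.+1, lo', hi', qs2, best', z'.
  have vi : v \notin take i qs1.
    have := take_uniq i.+1 (search_uniq (visit_search V')).
    by rewrite tE rcons_uniq => /andP[].
  rewrite (todo_rcons vi) tE /=; lia.
move=> f s1 t [k [i [lo [hi [qs1 [best [z [V ->]]]]]]]] /=.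
rewrite (visit6 V) (visit5 V) => iq; have {}iq : size qs1 <= i by lia.
have [Dlo loi ihi hiq qn] := visiting_bounds V.
move=> tle; have iE : i = hi by lia.
have hE : size qs1 = hi by lia.
have S := visit_search V; rewrite iE in S.
have [L0 memq] := searching_end D_closed zD hE S.
have lev u : (u \in drop lo (take i qs1)) = (u \in level e z0 k).
  by rewrite iE (searching_level D_closed zD u S).
have bst u : u \in level e z0 k -> best <= size (adj u).
  by rewrite -lev; apply: (visit_best V).
have [zk zE] : z \in level e z0 k /\ size (adj z) = best.
  (* The value [n] is excluded: the last level is nonempty and all degrees are below [n]. *)
  case: (visit_at V) => [bn|[zi ->]]; last by rewrite -lev.
  have : nth z (drop lo (take i qs1)) 0 \in drop lo (take i qs1).
    apply: mem_nth; have := search_lt S.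
    by rewrite size_drop iE size_takel // subn_gt0.
  by rewrite lev => /bst; rewrite bn leqNgt size_adj_lt.
have tq1 : take i qs1 = qs1 by rewrite take_oversize.
exists k, qs1, z; split; last by rewrite tq1 in tle *; lia.
split=> //.
- exact: visit_inputs V.
- exact: visit_queue V.
- exact: search_uniq S.
- by move=> u; rewrite inE memq.
- by move=> u /bst; rewrite zE.
- exact: visit4 V.
- exact: visit5 V.
move=> x; rewrite (visit_count V) tq1; congr Posz; apply: eq_card => u.
by rewrite !inE memq.
Qed.

End Component.
End Arrays.
End Inputs.

(** * Correctness and running time *)

(** The old left ends on [D] and the formula on the new component do not conflict: the search avoids
    [D], and levels are disjoint. *)
Lemma ex_left_position (T : finType) (e : rel T) (D : {set T}) (L : T -> nat) z :
  closed e D -> z \notin D -> exists2 Lf : T -> nat,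
    forall u, u \in D -> Lf u = L u &
    forall k u, u \in level e z k ->
      Lf u = #|D| + #|before e z k :\: [set w | e u w]|.
Proof.
move=> clD zD.
have ex u : exists y, (u \in D -> y = L u) /\ forall k, u \in level e z k ->
    y = #|D| + #|before e z k :\: [set w | e u w]|.
  have [uD|uD] := boolP (u \in D).
    exists (L u); split=> // k /(level_notin_found clD zD).
    by rewrite uD.
  have [[k uk]|nk] := EM (exists k, u \in level e z k); last first.
    by exists 0; split=> // k uk; case: nk; exists k.
  exists (#|D| + #|before e z k :\: [set w | e u w]|); split=> // j uj.
  by rewrite (level_unique uk uj).
have [Lf LfP] := fin_all_exists ex.
by exists Lf => [u|k u]; have [H1 H2] := LfP u; [apply: H1|apply: H2].
Qed.

(** Both searches are exhausted, so both sets are closed. If [s] were outside the second set, the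
    closed complement would contain everything reached from [s], in particular [z]. *)
Lemma same_component (T : finType) (e : rel T) s k z j : symmetric e ->
  level e s k.+1 = set0 -> level e z j.+1 = set0 -> z \in before e s k.+1 ->
  before e s k.+1 = before e z j.+1.
Proof.
move=> e_sym L1 L2 zC; apply/eqP; rewrite eqEsubset.
have cl1 := before_closed e_sym L1; have cl2 := before_closed e_sym L2.
rewrite [X in _ && X]before_sub_closed // andbT; apply: before_sub_closed => //.
apply: contraT => sC.
have cl : closed e (~: before e z j.+1) by move=> u v euv; rewrite !inE (cl2 _ _ euv).
have sC' : s \in ~: before e z j.+1 by rewrite inE.
by have := subsetP (before_sub_closed k.+1 cl sC') _ zC; rewrite inE before_id.
Qed.

Section Main.
Variables (n : nat) (e : rel 'I_n) (adj : 'I_n -> seq 'I_n) (W : nat).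
Hypothesis W_large : 2 * n + arcs adj + 5 <= W.
Hypothesis e_sym : symmetric e.
Hypothesis e_irr : irreflexive e.
Hypothesis adj_uniq : forall u, uniq (adj u).
Hypothesis adjE : forall u v, (v \in adj u) = e u v.

Definition counted (a : nat) (D : {set 'I_n}) (L : 'I_n -> nat) (s : state) :=
  forall x : nat, arr s a (Posz x) = Posz #|[set u in D | L u == x]|.

Lemma eq_counted a (D : {set 'I_n}) (L L' : 'I_n -> nat) s : (forall u, u \in D -> L' u = L u) ->
  counted a D L s -> counted a D L' s.
Proof.
move=> LE cnt x; rewrite cnt; congr Posz; apply: eq_card => u.
by rewrite !inE; case uD: (u \in D); rewrite //= LE.
Qed.

(** Invariant of the outer loop: [D] is the set of vertices in finished components, and both queues
    list it. The left ends [L2] from the second searches belong to the placement. *)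
Record ordering (j : nat) (D : {set 'I_n}) (qs1 qs2 : seq 'I_n)
    (s1 L1 L2 : 'I_n -> nat) (s : state) : Prop := Ordering {
  ord_inputs : inputs adj s;
  ord_le : j <= n;
  ord2 : var s 2 = Posz j;
  ord3 : var s 3 = Posz #|D|;
  ord_closed : closed e D;
  ord_found : forall u : 'I_n, u < j -> u \in D;
  ord_queue1 : queue 2 3 qs1 s;
  ord_queue2 : queue 5 6 qs2 s;
  ord_uniq1 : uniq qs1;
  ord_uniq2 : uniq qs2;
  ord_mem1 : qs1 =i D;
  ord_mem2 : qs2 =i D;
  ord_counted1 : counted 4 D L1 s;
  ord_counted2 : counted 7 D L2 s;
  ord_placed : placed e 0 D s1 L2
}.

Lemma run_order lt s : straight e lt -> inputs adj s ->
  (forall x, 0 < x -> x != 1 -> var s x = 0) ->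
  (forall a i, 1 < a -> arr s a i = 0) ->
  run W order_vertices s (fun t s' =>
    t <= 300 * n + 2 * todo adj [::] + 10 /\
    exists s1 L, [/\ inputs adj s', placed e 0 [set: 'I_n] s1 L
      & counted 7 [set: 'I_n] L s']).
Proof.
move=> st inp vz az.
(* 300 per candidate source covers the overhead of two searches, 50 each, and of the loop; the
   potentials pay for the visits. *)
pose I f s' := exists j D qs1 qs2 s1 L1 L2,
  ordering j D qs1 qs2 s1 L1 L2 s' /\
  f = 300 * (n - j) + todo adj qs1 + todo adj qs2.
have counted0 x : #|[set u in set0 | (fun=> 0) (u : 'I_n) == x]| = 0.
  by apply: eq_card0 => u; rewrite !inE.
apply: (@run_while W I _ _ (300 * n + todo adj [::] + todo adj [::])).
- exists 0, set0, [::], [::], (fun=> 0), (fun=> 0), (fun=> 0).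
  rewrite subn0; split=> //; split=> //.
  + by rewrite vz.
  + by rewrite vz // cards0.
  + by move=> u v _; rewrite !inE.
  + by split=> // v; rewrite az.
  + by split=> // v; rewrite az.
  + by move=> u; rewrite inE.
  + by move=> u; rewrite inE.
  + by move=> x; rewrite az // counted0.
  + by move=> x; rewrite az // counted0.
  + exact: placed0.
- move=> f s1 [j [D [qs1 [qs2 [pos [L1 [L2 [O _]]]]]]]] /=.
  rewrite (ord2 O); have [-> _ _] := ord_inputs O; have := ord_le O; lia.
- move=> f s1 [j [D [qs1 [qs2 [pos [L1 [L2 [O fE]]]]]]]] /=.
  have [inp1 jn v2 v3 clD found q1 q2 u1 u2 m1 m2 c1 c2 pl] := O.
  have [v0 _ _] := inp1; rewrite v2 v0 => jlt; have {}jlt : j < n by lia.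
  pose u0 := Ordinal jlt.
  have a2 : arr s1 2 (Posz j) = Posz (if u0 \in qs1 then (index u0 qs1).+1 else 0).
    by case: q1 => /(_ u0).
  have sz1 := uniq_size_ord u1.
  have szD qs : uniq qs -> qs =i D -> size qs = #|D|.
    by move=> /card_uniqP <- qD; apply: eq_card.
  apply: run_seq; apply: run_if.
  + rewrite /= v2 a2; case: ifP => [|_]; last by lia.
    by have := leq_trans (index_size u0 qs1) sz1; move: (index _ _) => p; lia.
  + rewrite /= v2 a2; case: ifP => // /negbT; rewrite m1 => uD _.
    apply: run_seq; apply: run_assign; first by rewrite /= v2; lia.
    rewrite /= v2; set s2 := set_var _ _ _.
    have [Lf1 LfD1 LfE1] := ex_left_position L1 clD uD.
    have inp2 : inputs adj s2 by case: inp1 => *; split.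
    have v32 : var s2 3 = Posz (size qs1) by rewrite (szD qs1).
    have v32' : var s2 3 = Posz (size qs2) by rewrite (szD qs2).
    have c12 : counted 4 D Lf1 s2 := eq_counted LfD1 c1.
    have bfs1 := run_bfs W_large (isT : uniq [:: 0; 1; 2; 3; 4]) e_irr
      adj_uniq adjE clD uD LfE1 inp2 q1 u1 m1 v32 erefl c12.
    apply: run_seq; apply: run_conseq (run_framed bfs1).
    move=> t s3 [[k [qs1' [z [S tle]]]] [fv fa]].
    have LE := searched_last S.
    have zC : z \in before e u0 k.+1 by rewrite beforeS inE (searched_level S) orbT.
    have zD : z \notin D := before_notin_found clD uD zC.
    have [Lf2 LfD2 LfE2] := ex_left_position L2 clD zD.
    have v33 : var s3 3 = Posz (size qs2) by rewrite fv.
    have q23 : queue 5 6 qs2 s3.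
      by case: q2 => *; split; rewrite fa //.
    have c23 : counted 7 D Lf2 s3 by apply: (eq_counted LfD2) => x; rewrite fa //; apply: c2.
    have bfs2 := run_bfs W_large (isT : uniq [:: 0; 1; 5; 6; 7]) e_irr
      adj_uniq adjE clD zD LfE2 (searched_inputs S) q23 u2 m2 v33 (searched4 S) c23.
    apply: run_seq; apply: run_conseq (run_framed bfs2).
    move=> t2 s4 [[k2 [qs2' [z2 [S2 tle2]]]] [fv2 fa2]].
    have LE2 := searched_last S2.
    have CE := same_component e_sym LE LE2 zC.
    have w5 := searched5 S2; have szq := uniq_size_ord (searched_uniq S2).
    apply: run_assign; first by rewrite /= w5; lia.
    have w2 : var s4 2 = Posz j by rewrite fv2 // fv.
    apply: run_assign; rewrite /= w2; first by lia.
    have tE qs : qs =i D -> todo adj qs = todo adj qs1.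
      by move=> qD; apply: eq_bigl => u; rewrite qD m1.
    exists (300 * (n - j.+1) + todo adj qs1' + todo adj qs2').
      exists j.+1, (D :|: before e z k2.+1), qs1', qs2'.
      (* The source of the second search has least degree in the last level of the first, so some
         straight order puts it first in the component. *)
      have [lt' st' minz] : exists2 lt', straight e lt' &
          {in before e z k2.+1, forall v, v != z -> lt' z v}.
        have [|lt' st' minz] := last_level_first e_sym e_irr st LE (searched_level S).
          by move=> y yk; rewrite -!(size_adj adj_uniq adjE) (searched_min S).
        by exists lt' => // v; rewrite -CE; apply: minz.
      have pl' := layers_placed e_sym e_irr st' LE2 minz LfE2.
      have disj : [disjoint D & before e z k2.+1].
        rewrite disjoint_sym disjoints_subset; apply/subsetP => v.
        by move=> /(before_notin_found clD zD); rewrite inE.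
      have plU := placedU clD disj pl pl'.
      eexists; exists Lf1; eexists; split; last by [].
      have mem2 u : (u \in qs2') = (u \in D :|: before e z k2.+1) := searched_mem S2 u.
      split; [..|exact: plU].
      * by have [? ? ?] := searched_inputs S2; split.
      * by [].
      * by rewrite /=; lia.
      * rewrite /= w5 -(card_uniqP (searched_uniq S2)); congr Posz.
        by apply: eq_card => u; rewrite mem2.
      * move=> u v euv; rewrite !inE (clD _ _ euv).
        by rewrite (before_closed e_sym LE2 euv).
      * move=> u; rewrite ltnS leq_eqVlt => /orP[/eqP uj|/found uD']; rewrite inE ?uD' //.
        by have -> : u = u0 by [apply: val_inj]; rewrite -CE before_id orbT.
      * by have [? ?] := searched_queue S; split; rewrite /= fa2.
      * by have [? ?] := searched_queue S2; split.
      * exact: searched_uniq S.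
      * exact: searched_uniq S2.
      * by move=> u; rewrite (searched_mem S) CE.
      * exact: mem2.
      * by move=> x /=; rewrite fa2 // (searched_count S) CE.
      * have c4 : counted 7 (D :|: before e z k2.+1) Lf2 s4 := searched_count S2.
        apply: eq_counted c4 => u; rewrite !inE; case: ifP => // uD' _.
        by rewrite LfD2.
    by have := tE _ m2; rewrite fE /=; lia.
  + rewrite /= v2 a2; case: ifP => // uq _.
    apply: run_skip; apply: run_assign; rewrite /= v2; first by lia.
    exists (300 * (n - j.+1) + todo adj qs1 + todo adj qs2); last by rewrite fE /=; lia.
    exists j.+1, D, qs1, qs2, pos, L1, L2; split=> //; split=> //=.
    * by lia.
    * move=> u; rewrite ltnS leq_eqVlt => /orP[/eqP uj|/found //].
      by have -> : u = u0 by [apply: val_inj]; rewrite -m1.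
move=> f s1 t [j [D [qs1 [qs2 [pos [L1 [L2 [O fE]]]]]]]] /=.
have [inp1 jn v2 v3 clD found q1 q2 u1 u2 m1 m2 c1 c2 pl] := O.
have [v0 _ _] := inp1; rewrite v2 v0 => jlt tle; have {}jlt : j = n by lia.
have DT : D = [set: 'I_n] by apply/setP => u; rewrite inE found // jlt.
split; first by lia.
by exists pos, L2; split; rewrite -?DT.
Qed.

(** * The greedy scan and the answer *)

Lemma greedy_count (L : 'I_n -> nat) m : (greedy L m).1.1 <= m.
Proof.
elim: m => //= m; case: (greedy L m) => [[r f1] f2] /= le_r.
by case: ifP => _ //=; apply: ltnW.
Qed.

Lemma greedy_fits (L : 'I_n -> nat) m :
  (greedy L m).1.2 <= n.+1 /\ (greedy L m).2 <= n.+1.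
Proof.
elim: m => //= m; case: (greedy L m) => [[r f1] f2] /= [le1 le2].
case: ifP => _ //=; split=> //.
by rewrite ltnS /cum -[leqRHS]card_ord max_card.
Qed.

Record choosing (L : 'I_n -> nat) (k : int) (m r f1 f2 : nat) (s : state)
    : Prop := Choosing {
  choose_le : m <= n;
  choose_greedy : greedy L m = (r, f1, f2);
  choose0 : var s 0 = Posz n;
  choose1 : var s 1 = k;
  choose6 : var s 6 = Posz m;
  choose16 : var s 16 = Posz #|[set u | L u < m]|;
  choose19 : var s 19 = Posz r;
  choose17 : var s 17 = Posz f1;
  choose18 : var s 18 = Posz f2;
  choose_counted : counted 7 [set: 'I_n] L s
}.

Lemma run_choose (L : 'I_n -> nat) (k : int) s : var s 0 = Posz n ->
  var s 1 = k -> (forall x, 15 < x -> var s x = 0) ->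
  counted 7 [set: 'I_n] L s ->
  run W choose_cliques s (fun t s' => t <= 100 * n + 10 /\
    [/\ var s' 0 = Posz n, var s' 1 = k
      & var s' 19 = Posz (greedy L n).1.1]).
Proof.
move=> v0 v1 vz cnt.
apply: run_seq; apply: run_assign; rewrite /=; first by lia.
pose I f s' := exists m r f1 f2, choosing L k m r f1 f2 s' /\ f = 100 * (n - m).
apply: (@run_while W I _ _ (100 * n)).
- exists 0, 0, 0, 0; rewrite subn0; split=> //; split=> //=; rewrite ?vz //.
  by rewrite (_ : [set u | L u < 0] = set0) ?cards0 //; apply/setP => u; rewrite !inE.
- move=> f s1 [m [r [f1 [f2 [C _]]]]] /=.
  rewrite (choose6 C) (choose0 C); have := choose_le C; lia.
- move=> f s1 [m [r [f1 [f2 [C fE]]]]] /=.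
  have [mn gr w0 w1 w6 w16 w19 w17 w18 c7] := C.
  rewrite w6 w0 => mlt; have {}mlt : m < n by lia.
  have x7 := c7 m; set x := #|[set u in _ | _]| in x7.
  (* Variable 16 is a running sum of the counters, so adding the counter of [m] produces
     [cum L m]. *)
  have cumE : cum L m = #|[set u | L u < m]| + x.
    rewrite /cum -[x in _ + x](_ : #|[set u | L u == m]| = x); last first.
      by apply: eq_card => u; rewrite !inE.
    have <- : #|[set u | L u < m] :|: [set u | L u == m]| = #|[set u | L u <= m]|.
      by apply: eq_card => u; rewrite !inE orbC -leq_eqVlt.
    rewrite cardsU (_ : _ :&: _ = set0) ?cards0 ?subn0 //.
    by apply/setP => u; rewrite !inE; case: ltngtP.
  have endE : left_end L m = (0 < x).
    apply/existsP/card_gt0P => -[u].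
      by move=> Lu; exists u; rewrite !inE.
    by rewrite !inE => Lu; exists u.
  have cumn : cum L m <= n by rewrite /cum -[leqRHS]card_ord max_card.
  have cumS : cum L m = #|[set u | L u < m.+1]| by [].
  have sum16 : (var s1 16 + Posz x)%R = Posz (cum L m) by rewrite w16 -PoszD cumE.
  have fit16 : absz (var s1 16) <= W.
    rewrite w16 /=; apply: leq_trans (_ : cum L m <= W); last by lia.
    by rewrite cumE leq_addr.
  have [le1 le2] := greedy_fits L m; have ler := greedy_count L m.
  have gS : greedy L m.+1 = if (0 < x) && (f1 <= m)
      then (r.+1, f2, (cum L m).+1) else (r, f1, f2) by rewrite /= gr endE.
  rewrite gr /= in le1 le2 ler.
  apply: run_seq; apply: run_assign; rewrite /= w6 x7 sum16; first by lia.
  apply: run_seq; apply: run_if; rewrite /= ?w6 ?x7 ?w17; first by lia.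
  + move=> take_m; have {}take_m : (0 < x) && (f1 <= m) by lia.
    rewrite take_m in gS.
    apply: run_seq; apply: run_assign; rewrite /= w19; first by lia.
    apply: run_seq; apply: run_assign; rewrite /= w18; first by lia.
    apply: run_assign; rewrite /=; first by lia.
    apply: run_assign; rewrite /= w6; first by lia.
    exists (100 * (n - m.+1)); last by lia.
    exists m.+1, r.+1, f2, (cum L m).+1; split=> //; split=> //=; lia.
  + move=> skip_m; have {}skip_m : (0 < x) && (f1 <= m) = false by lia.
    rewrite skip_m in gS.
    apply: run_skip; apply: run_assign; rewrite /= w6; first by lia.
    exists (100 * (n - m.+1)); last by lia.
    exists m.+1, r, f1, f2; split=> //; split=> //=; lia.
move=> f s1 t [m [r [f1 [f2 [C fE]]]]] /=.
have [mn gr w0 w1 w6 w16 w19 w17 w18 c7] := C.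
rewrite w6 w0 => mlt tle; have mE : m = n by lia.
by rewrite mE in gr; rewrite gr; split; [lia|].
Qed.

(** Over the integers [k < r + 1] expresses [k <= r]; the test on [n] rejects the graph without
    vertices. *)
Lemma run_answer (r : nat) (k : int) s : var s 0 = Posz n ->
  var s 1 = k -> var s 19 = Posz r -> r <= n -> absz k <= W ->
  run W answer s (fun t s' => t <= 20 /\
    var s' 0 = Posz ((0 < n) && (k <= Posz r)%R)).
Proof.
move=> v0 v1 v19 rn kW; apply: run_if; rewrite /= ?v0 ?v1 ?v19; first by lia.
  move=> yes; apply: run_assign; rewrite /=; first by lia.
  by split=> //; have -> : (0 < n) && (k <= r)%R by lia.
move=> no; apply: run_assign; rewrite /=; first by lia.
by split=> //; have -> : (0 < n) && (k <= r)%R = false by lia.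
Qed.

(** An edge comes from at most two ordered pairs, [(a, b)] and [(b, a)]. *)
Lemma arcs_edges : arcs adj <= 2 * #|edges e|.
Proof.
pose E := [set p : 'I_n * 'I_n | e p.1 p.2].
have -> : arcs adj = #|E|.
  rewrite -sum1_card /arcs (eq_bigr (fun u => \sum_(v | e u v) 1)).
    by rewrite pair_big_dep /=; apply: eq_bigl => p; rewrite inE.
  move=> u _; rewrite sum1_card (size_adj adj_uniq adjE) /degree.
  by apply: eq_card => v; rewrite inE.
pose h (p : 'I_n * 'I_n) := [set p.1; p.2].
have -> : edges e = h @: E.
  by apply/setP => A; apply/imsetP/imsetP => -[p]; rewrite ?inE => pE ->; exists p; rewrite ?inE.
rewrite -sum1_card (partition_big_imset h) /= mulnC -sum_nat_const.
apply: leq_sum => A /imsetP[[a b] _ ->].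
rewrite sum1dep_card; apply: leq_trans (_ : #|[set (a, b); (b, a)]| <= 2); last first.
  by rewrite cards2; case: (_ == _).
apply: subset_leq_card; apply/subsetP => -[c d]; rewrite !inE /h /= => /andP[_ /eqP hE].
have := set21 c d; have := set22 c d; rewrite hE !inE.
have := set21 a b; have := set22 a b; rewrite -hE !inE !xpair_eqE ![a == _]eq_sym ![b == _]eq_sym.
by case: (c == a); case: (c == b); case: (d == a); case: (d == b).
Qed.

End Main.

Theorem theorem5p12 (R : realType) :
  exists p : program,
    solves_in_linear_time
      (fun n (e : rel 'I_n) => proper_interval_graph e R)
      (fun n (e : rel 'I_n) (k : int) => upper_clique_transversal e k)
      p.
Proof.
(* Ordering costs at most [520 * n + 60 * arcs adj + 10], the scan [100 * n + 10], the answer 20,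
   and there are at most two arcs per edge; 1000 covers this and the word bound. *)
exists uct_program, 1000 => n e adj k e_sym e_irr /interval_straight[lt st] adjP.
have adj_uniq u : uniq (adj u) by case: (adjP u).
have adjE u v : (v \in adj u) = e u v by case: (adjP u) => _ ->.
have am := arcs_edges adj_uniq adjE.
set W := 1000 * _; have WE : W = 1000 * (n + #|edges e| + `|k| + 1) by [].
clearbody W.
have W_large : 2 * n + arcs adj + 5 <= W by lia.
have todo0 : todo adj [::] = 30 * arcs adj + 110 * n.
  rewrite /todo (eq_bigl xpredT) // big_split /= -big_distrr /=.
  by rewrite [X in _ + X]big_const_ord iter_addn_0.
suff [t [s [ps [tle sE]]]] : run W uct_program (input adj k) (fun t s =>
    t <= 1000 * (n + #|edges e| + 1) /\
    output s = Posz (upper_clique_transversal e k)) by exists t, s.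
apply: run_seq; have := run_order W_large e_sym e_irr adj_uniq adjE st (input_inputs adj k).
move=> /(_ _ _)/run_framed-order.
apply: run_conseq (order _ _) => [t s [[tle [pos [L [inp pl cnt]]]] [fv _]]| |]; last first.
- by move=> [|[|a]].
- by move=> [|[|x]].
have [v0 _ _] := inp.
apply: run_seq; apply: run_conseq (run_choose W_large v0 (fv 1 isT) _ cnt).
  move=> t2 s2 [tle2 [w0 w1 w19]].
  apply: run_conseq (run_answer W_large w0 w1 w19 (greedy_count L n) _).
    move=> t3 s3 [tle3 out]; split; first by move: tle; rewrite todo0; lia.
    rewrite /output out (upper_clique_transversal_greedy e_sym pl) card_ord.
    by [].
  by rewrite /=; lia.
by move=> x x15; rewrite fv; [case: x x15 => [|[|x]]|rewrite /=; lia].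
Qed.
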